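(* There exists an algorithm that, given any clustered graph $C(G,T)$ whose underlying graph $G$ is planar and has $n$ vertices, computes an $\langle \alpha,0,0\rangle$-drawing of $C(G,T)$ with $\alpha \in O(n^2)$.
   Context: A clustered graph $C(G,T)$ consists of a graph $G$ and a rooted tree $T$ whose leaves are exactly the vertices of $G$; each internal node $\mu$ of $T$ is a cluster, identified with the set $V(\mu)$ of leaves of the subtree rooted at $\mu$. A drawing of $C(G,T)$ maps vertices to distinct points, edges to open curves between their endpoints, and each internal node $\mu$ of $T$ to a simple closed region $R(\mu)$ containing all and only the vertices of $\mu$, with $R(\nu)\supseteq R(\mu)$ whenever $\mu$ is a descendant of $\nu$. Intersections among curves (edges and region boundaries) are isolated points, no three curves meet at a point, and two curves alternate around each intersection point. An edge-edge crossing is a crossing between two edges. If an edge $e$ crosses the boundary of $R(\mu)$ exactly $k$ times, this contributes $\lfloor k/2\rfloor$ edge-region crossings. For clusters $\mu,\nu$ neither of which is an ancestor of the other, the number of region-region crossings between them is the number of connected components of $R(\mu)\setminus R(\nu)$ minus one. An $\langle\alpha,\beta,\gamma\rangle$-drawing is a drawing with exactly $\alpha$ edge-edge, $\beta$ edge-region and $\gamma$ region-region crossings. Here $n$ is the number of vertices of $G$. *)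

(* Defs.v *)
From HB Require Import structures.
From mathcomp Require Import all_boot all_order all_algebra.
From mathcomp Require Import all_classical all_reals all_analysis.

Set Implicit Arguments.
Unset Strict Implicit.
Unset Printing Implicit Defensive.

Import Order.TTheory GRing.Theory Num.Theory.
Import numFieldNormedType.Exports.

Local Open Scope card_scope.
Local Open Scope classical_set_scope.
Local Open Scope ring_scope.

(* Nodes of the rooted tree are the vertices ('I_n, the leaves) and the clusters
   ('I_k, the internal nodes); only clusters can be parents. *)
Section RootedTree.
Variables (n k : nat) (par : 'I_n + 'I_k -> option 'I_k).

Definition parent_rel : rel ('I_n + 'I_k) :=
  [rel x y | if par x is Some mu then inr mu == y else false].

(* The first clause gives a unique root and excludes cycles; the second one
   says that no cluster is a leaf. *)
Definition rooted_tree : Prop :=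
  (exists2 r, par r = None & forall x, connect parent_rel x r) /\
  (forall mu, exists x, par x = Some mu).

End RootedTree.

Record cgraph := CGraph {
  nvert : nat;
  nclus : nat;
  adj : rel 'I_nvert;
  adj_sym : symmetric adj;
  adj_irr : irreflexive adj;
  par : 'I_nvert + 'I_nclus -> option 'I_nclus;
  par_tree : rooted_tree par }.

(* [ancestor mu x]: reflexive, i.e. x lies in the subtree rooted at mu *)
Definition ancestor (C : cgraph) (mu : 'I_(nclus C))
    (x : 'I_(nvert C) + 'I_(nclus C)) : bool :=
  connect (parent_rel (@par C)) x (inr mu).

Definition cluster_verts (C : cgraph) (mu : 'I_(nclus C)) : {set 'I_(nvert C)} :=
  [set v | ancestor mu (inl v)]%SET.

Definition cedge (C : cgraph) : finType :=
  {e : 'I_(nvert C) * 'I_(nvert C) | (e.1 < e.2)%N && adj e.1 e.2}.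

Section Drawings.
Variable R : realType.

Notation plane := (R * R)%type.

Definition simple_arc (g : R -> plane) (p q : plane) : Prop :=
  [/\ {within `[0, 1], continuous g}, {in `[0, 1] &, injective g},
      g 0 = p & g 1 = q].

Definition closed_arc (g : R -> plane) : set plane := g @` `[0, 1].
Definition open_arc (g : R -> plane) : set plane := g @` `]0, 1[.

Definition graph_drawing (C : cgraph)
    (pt : 'I_(nvert C) -> plane) (ed : cedge C -> R -> plane) : Prop :=
  [/\ injective pt,
      forall e, simple_arc (ed e) (pt (val e).1) (pt (val e).2) &
      forall e v, ~ open_arc (ed e) (pt v)].

Definition planar (C : cgraph) : Prop :=
  exists pt ed, @graph_drawing C pt ed /\
    forall e f, e != f -> open_arc (ed e) `&` open_arc (ed f) = set0.

Definition unit_disc : set plane := [set p | p.1 ^+ 2 + p.2 ^+ 2 <= 1].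

(* A continuous injection of the compact disc is an embedding. *)
Definition simple_closed_region (A : set plane) : Prop :=
  exists f : plane -> plane,
    [/\ {within unit_disc, continuous f},
        {in unit_disc &, injective f} & f @` unit_disc = A].

Definition boundary (A : set plane) : set plane := closure A `\` interior A.

(* The four branches of A and B leaving p alternate around p: some
   homeomorphism f : U -> V (with inverse g) between open neighbourhoods of p
   and of the origin maps A and B to the two coordinate axes. *)
Definition alternate (A B : set plane) (p : plane) : Prop :=
  exists (U V : set plane) (f g : plane -> plane),
    [/\ [/\ open U, open V, U p & f p = (0, 0)],
        [/\ (forall x, U x -> V (f x)), (forall y, V y -> U (g y)),
            (forall x, U x -> g (f x) = x) & (forall y, V y -> f (g y) = y)],
        (forall x, U x -> {for x, continuous f}) /\
        (forall y, V y -> {for y, continuous g}) &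
        (forall x, U x -> (A x <-> (f x).2 = 0) /\ (B x <-> (f x).1 = 0))].

Record drawing (C : cgraph) := Drawing {
  dpt : 'I_(nvert C) -> plane;
  dedge : cedge C -> R -> plane;
  dregion : 'I_(nclus C) -> set plane }.

Section DrawingOf.
Variables (C : cgraph) (D : drawing C).

Definition dcurve (i : cedge C + 'I_(nclus C)) : set plane :=
  match i with
  | inl e => open_arc (dedge D e)
  | inr mu => boundary (dregion D mu)
  end.

Definition is_drawing : Prop :=
  [/\ graph_drawing (dpt D) (dedge D),
      forall mu, simple_closed_region (dregion D mu),
      forall mu v, if v \in cluster_verts mu
                   then interior (dregion D mu) (dpt D v)
                   else ~ dregion D mu (dpt D v),
      forall mu nu, ancestor nu (inr mu) -> dregion D mu `<=` dregion D nu &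
      [/\ forall i j p, i != j -> (dcurve i `&` dcurve j) p ->
            isolated (dcurve i `&` dcurve j) p,
          forall i j l, i != j -> i != l -> j != l ->
            dcurve i `&` dcurve j `&` dcurve l = set0 &
          forall i j p, i != j -> (dcurve i `&` dcurve j) p ->
            alternate (dcurve i) (dcurve j) p]].

Definition components (A : set plane) : set (set plane) :=
  [set connected_component A x | x in A].

Definition unrelated (mu nu : 'I_(nclus C)) : bool :=
  ~~ ancestor mu (inr nu) && ~~ ancestor nu (inr mu).

(* [ee e f], [er e mu]: numbers of crossing points of two edges, and of an edge
   with the boundary of a region; [rr mu nu]: number of components of
   R(mu) \ R(nu) minus one.  Each unordered pair is counted once. *)
Definition crossings (alpha beta gamma : nat) : Prop :=
  exists (ee : cedge C -> cedge C -> nat) (er : cedge C -> 'I_(nclus C) -> nat)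
         (rr : 'I_(nclus C) -> 'I_(nclus C) -> nat),
    [/\ forall e f, e != f ->
          open_arc (dedge D e) `&` open_arc (dedge D f) #= `I_(ee e f),
        forall e mu,
          open_arc (dedge D e) `&` boundary (dregion D mu) #= `I_(er e mu),
        forall mu nu, unrelated mu nu ->
          components (dregion D mu `\` dregion D nu) #= `I_(rr mu nu).+1 &
        [/\ alpha = (\sum_e \sum_(f | enum_rank e < enum_rank f) ee e f)%N,
            beta = (\sum_e \sum_mu (er e mu %/ 2))%N &
            gamma = (\sum_(mu < nclus C)
                       \sum_(nu < nclus C | (mu < nu) && unrelated mu nu)
                         rr mu nu)%N]].

End DrawingOf.

Definition crossing_drawing (C : cgraph) (D : drawing C)
    (alpha beta gamma : nat) : Prop :=
  is_drawing D /\ crossings D alpha beta gamma.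

End Drawings.

(* Model of computation: Kleene's partial recursive functions, over data built
   from natural numbers by pairs and lists. *)
Inductive dty := Nat | Prod of dty & dty | List of dty.

Fixpoint dom (t : dty) : Type :=
  match t with
  | Nat => nat
  | Prod a b => (dom a * dom b)%type
  | List a => seq (dom a)
  end.

Inductive prog : dty -> dty -> Type :=
| Pid a : prog a a
| Pcomp a b c : prog b c -> prog a b -> prog a c
| Ppair a b c : prog a b -> prog a c -> prog a (Prod b c)
| Pfst a b : prog (Prod a b) a
| Psnd a b : prog (Prod a b) b
| Pzero a : prog a Nat
| Psucc : prog Nat Nat
| Pnatrec a b : prog a b -> prog (Prod a (Prod Nat b)) b -> prog (Prod a Nat) b
| Pnil a b : prog a (List b)
| Pcons a : prog (Prod a (List a)) (List a)
| Plistrec a b c : prog a c -> prog (Prod a (Prod (Prod b (List b)) c)) c ->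
    prog (Prod a (List b)) c
| Pmu a : prog (Prod a Nat) Nat -> prog a Nat.

(* [run p x y]: on input x the program p halts with output y *)
Fixpoint run (a b : dty) (p : prog a b) : dom a -> dom b -> Prop :=
  match p in prog a b return dom a -> dom b -> Prop with
  | Pid _ => fun x y => y = x
  | Pcomp _ _ _ q p => fun x z => exists2 y, run p x y & run q y z
  | Ppair _ _ _ p q => fun x y => run p x y.1 /\ run q x y.2
  | Pfst _ _ => fun x y => y = x.1
  | Psnd _ _ => fun x y => y = x.2
  | Pzero _ => fun _ y => y = 0%N
  | Psucc => fun x y => y = x.+1
  | Pnatrec _ b p q => fun x y =>
      (fix loop (m : nat) (y : dom b) : Prop :=
         if m is m'.+1 then exists2 z, loop m' z & run q (x.1, (m', z)) y
         else run p x.1 y) x.2 y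
  | Pnil _ _ => fun _ y => y = [::]
  | Pcons _ => fun x y => y = x.1 :: x.2
  | Plistrec _ b c p q => fun x y =>
      (fix loop (s : seq (dom b)) (y : dom c) : Prop :=
         if s is h :: s' then exists2 z, loop s' z & run q (x.1, ((h, s'), z)) y
         else run p x.1 y) x.2 y
  | Pmu _ p => fun x m =>
      run p (x, m) 0%N /\
      forall m', (m' < m)%N -> exists l : nat, run p (x, m') l.+1
  end.

Lemma run_functional (a b : dty) (p : prog a b) x y z :
  run p x y -> run p x z -> y = z.
Proof.
elim: a b / p x y z => /=.
- by move=> a x y z -> ->.
- move=> a b c q IHq p IHp x y z [u pu qu] [v pv qv].
  by rewrite (IHp _ _ _ pu pv) in qu; exact: IHq qu qv.
- move=> a b c p IHp q IHq x [y1 y2] [z1 z2] /= [p1 q1] [p2 q2].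
  by rewrite (IHp _ _ _ p1 p2) (IHq _ _ _ q1 q2).
- by move=> a b x y z -> ->.
- by move=> a b x y z -> ->.
- by move=> a x y z -> ->.
- by move=> x y z -> ->.
- move=> a b p IHp q IHq [x m] /=.
  elim: m => [|m IHm] y z /=; first exact: IHp.
  move=> [u lu qu] [v lv qv].
  by rewrite (IHm _ _ lu lv) in qu; exact: IHq qu qv.
- by move=> a b x y z -> ->.
- by move=> a x y z -> ->.
- move=> a b c p IHp q IHq [x s] /=.
  elim: s => [|h s IHs] y z /=; first exact: IHp.
  move=> [u lu qu] [v lv qv].
  by rewrite (IHs _ _ lu lv) in qu; exact: IHq qu qv.
- move=> a p IHp x y z [py ly] [pz lz].
  case: (ltngtP y z) => // lt.
  + by have [l /(IHp _ _ _ py)] := lz _ lt.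
  + by have [l /(IHp _ _ _ pz)] := ly _ lt.
Qed.

(* Input: number of vertices, number of clusters, list of edges, list of the
   parents of the vertices and then of the clusters (0 for the root, mu + 1 for
   a node with parent mu). *)
Definition input_ty : dty :=
  Prod (Prod Nat Nat) (Prod (List (Prod Nat Nat)) (List Nat)).

Definition code_parent (k : nat) (o : option 'I_k) : nat :=
  if o is Some mu then mu.+1 else 0%N.

Definition code_cgraph (C : cgraph) : dom input_ty :=
  ((nvert C, nclus C),
   ([seq (nat_of_ord (val e).1, nat_of_ord (val e).2) | e <- enum (cedge C)],
    [seq code_parent (par (inl v)) | v <- enum 'I_(nvert C)] ++
    [seq code_parent (par (inr mu)) | mu <- enum 'I_(nclus C)])).

(* ((a, b), d) stands for the rational number (a - b) / (d + 1) *)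
Definition rat_ty : dty := Prod (Prod Nat Nat) Nat.
Definition point_ty : dty := Prod rat_ty rat_ty.

(* Output: the points of the vertices, the polygonal lines of the edges (listed
   as in the input), the polygons bounding the regions. *)
Definition output_ty : dty :=
  Prod (List point_ty) (Prod (List (List point_ty)) (List (List point_ty))).

Section Decoding.
Variable R : realType.

Notation plane := (R * R)%type.

Definition rat_val (q : dom rat_ty) : R :=
  (q.1.1%:R - q.1.2%:R) / q.2.+1%:R.

Definition point_val (p : dom point_ty) : plane := (rat_val p.1, rat_val p.2).

Definition segment (p q : plane) : set plane :=
  [set ((1 - t) * p.1 + t * q.1, (1 - t) * p.2 + t * q.2) | t in `[0, 1]].

Fixpoint polyline (p : plane) (s : seq plane) : set plane :=
  if s is q :: s' then segment p q `|` polyline q s' else [set p].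

Definition open_polygonal (s : seq (dom point_ty)) : set plane :=
  if map point_val s is p :: s' then polyline p s' else set0.

Definition closed_polygonal (s : seq (dom point_ty)) : set plane :=
  if map point_val s is p :: s' then polyline p (rcons s' p) else set0.

(* A region is determined by its boundary, being bounded by a Jordan curve. *)
Definition describes (o : dom output_ty) (C : cgraph) (D : drawing R C) : Prop :=
  [/\ map point_val o.1 = [seq dpt D v | v <- enum 'I_(nvert C)],
      map open_polygonal o.2.1 =
        [seq closed_arc (dedge D e) | e <- enum (cedge C)] &
      map closed_polygonal o.2.2 =
        [seq boundary (dregion D mu) | mu <- enum 'I_(nclus C)]].

End Decoding.

(* Main.v *)
(** The plane drawing is built on the tree alone.  Every node of the tree gets
    an interval whose end points have the path from the root as their digits, so
    that the intervals of a node and of its ancestors are nested and all the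
    other pairs of intervals are disjoint.  A vertex is placed on the x-axis at
    the left end of its interval, and the region of a cluster is a rectangle over
    its interval whose height decreases with the depth of the cluster.  An edge
    goes up along a steep line, across at a height between those of its lowest
    common cluster and of the clusters below it, and down along a parallel line.
    Hence no rectangle is crossed twice by an edge, and two edges meet at most
    twice, always at the intersection of an oblique and of a horizontal segment.

    It remains to see that a planar graph has O(n) edges.  Sample the arcs of a
    planar drawing finely and let [w c ab] be the parity of the number of times
    the samples of the edge [ab] cross the horizontal ray issued from [c].  For
    two edges [ab] and [cd] without common end point, the differences of samples
    form a grid of points avoiding the origin, and adding up its cells shows that
    [w c ab + w d ab + w a cd + w b cd] only depends on the lexicographic order of
    the end points: this is van Kampen's obstruction.  The relation extends to
    vertex disjoint walks, and adding up its 15 instances for the pairs of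
    disjoint edges of a [K_5] minor gives a contradiction, while by Mader's
    theorem a graph with at least [4 n] edges has such a minor. *)

(* The arcs of a planar drawing are merely continuous, so an arc may meet a ray infinitely often.
   Samples turn this count into a finite parity, and compactness gives the distance between
   independent edges against which the sampling step is chosen. What remains is an identity modulo
   2: over the 15 pairs every winding term occurs twice, while the order terms leave an odd
   constant. All coordinates of the drawing are integers. An edge has a rank [s] between 1 and the
   number [m] of edges, used twice: as the inverse slope of its oblique segments, which separates
   those issued from one vertex, and as the residue of its height modulo [m + 1], which separates
   the horizontal segments. The base of the digits exceeds every product of rank and height, so
   oblique segments stay within the strip of their vertex. The constants: more than [4 n] edges give
   at least [2 ^ 3 * n] ordered adjacent pairs, the density at which Mader's argument yields [K_5];
   two crossings for each pair of edges give [2 * (4 n) ^ 2 = 32 n ^ 2]. *)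
Require Import Defs.
From mathcomp Require Import all_boot all_order all_algebra.
From mathcomp Require Import zify ring lra.

Set Implicit Arguments.
Unset Strict Implicit.
Unset Printing Implicit Defensive.

Import Order.TTheory GRing.Theory Num.Theory.

Local Open Scope ring_scope.

(** * Complete minors of dense graphs *)

Section DenseMinors.
Local Open Scope nat_scope.
Variable V : finType.
Implicit Types (adj : rel V) (S : {set V}).

(** Ordered pairs are counted, so every edge counts twice and the density of [S] is its average
    degree. *)
Definition arcs_in adj S : nat := \sum_(a in S) \sum_(b in S) adj a b.

Lemma arcs_inU1 adj S y : symmetric adj -> irreflexive adj -> y \notin S ->
  arcs_in adj (y |: S) = arcs_in adj S + 2 * \sum_(b in S) adj y b.
Proof.
move=> sym irr yS; rewrite /arcs_in big_setU1//= big_setU1//= irr add0n.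
under [X in _ + X = _]eq_bigr => a aS do rewrite big_setU1//=.
rewrite big_split /= addnA addnC mul2n -addnn; congr (_ + (_ + _)).
by apply: eq_bigr => a _; rewrite sym.
Qed.

(** The vertex type stays fixed: [x] inherits the neighbours of [y], and [y] is discarded by passing
    to [S :\ y]. The conjunct [a != b] removes the loop left by the edge between [x] and [y]. *)
Definition contract adj (x y : V) : rel V := [rel a b | (a != b) &&
  [|| adj a b, (a == x) && adj y b | (b == x) && adj a y]].

Lemma contract_sym adj x y : symmetric adj -> symmetric (contract adj x y).
Proof.
move=> sym a b; rewrite /contract /= eq_sym (sym a b) (sym y b) (sym a y).
by congr (_ && (_ || _)); rewrite orbC.
Qed.

Lemma contract_irr adj x y : irreflexive (contract adj x y).
Proof. by move=> a; rewrite /contract /= eqxx. Qed.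

(** Contraction loses the edge [x y] itself, which is the final 2, and one of the two edges to each
    common neighbour of [x] and [y]. *)
Lemma arcs_in_contract adj S x y : symmetric adj -> irreflexive adj ->
  x \in S -> y \in S -> adj x y ->
  arcs_in adj S = arcs_in (contract adj x y) (S :\ y)
    + 2 * (\sum_(b in S) (adj x b && adj y b)) + 2.
Proof.
move=> sym irr xS yS xy.
have nxy : x != y by apply: contraTneq xy => ->; rewrite irr.
pose T := S :\ y :\ x.
have xT : x \notin T by rewrite !inE eqxx.
have ST : S :\ y = x |: T by rewrite setD1K// !inE nxy.
have yT : y \notin x |: T by rewrite -ST !inE eqxx.
have SE : S = y |: (x |: T) by rewrite -ST setD1K.
rewrite ST {1 2}SE !arcs_inU1 ?contract_irr//; last first.
  exact: contract_irr.
  exact: contract_sym.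
rewrite !(big_setU1 _ yT) !(big_setU1 _ xT) /= !irr andbF /= (sym y x) xy.
have -> : arcs_in (contract adj x y) T = arcs_in adj T.
  apply: eq_bigr => a aT; apply: eq_bigr => b bT; rewrite /contract /=.
  have -> : (a == x) = false by apply: contraNF xT => /eqP <-.
  have -> : (b == x) = false by apply: contraNF xT => /eqP <-.
  rewrite !orbF; case: eqVneq => //= ->; by rewrite irr.
(* Inclusion and exclusion for the neighbourhoods of [x] and [y] outside these two vertices. *)
have : \sum_(b in T) contract adj x y x b + \sum_(b in T) (adj x b && adj y b)
    = \sum_(b in T) adj x b + \sum_(b in T) adj y b.
  rewrite -!big_split /=; apply: eq_bigr => b bT; rewrite /contract /= eqxx.
  have nbx : (b == x) = false by apply: contraNF xT => /eqP <-.
  by rewrite eq_sym nbx /= orbF; case: (adj x b); case: (adj y b).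
lia.
Qed.

(* The contraction of each branch set to its root is a complete graph: the walk
   between two roots stays in their two branch sets. *)
Definition complete_minor k adj S : Prop :=
  exists (B : 'I_k -> {set V}) (r : 'I_k -> V),
  [/\ forall i, r i \in B i, forall i, B i \subset S,
      forall i j, i != j -> [disjoint B i & B j] &
      forall i j, i != j ->
        connect [rel a b | [&& adj a b, a \in B i :|: B j & b \in B i :|: B j]]
          (r i) (r j)].

(** If some branch set contains [x], it also receives [y]. An edge of the contracted graph that is
    new comes from a neighbour of [y], and is replaced by a walk of length two through [y], which
    stays in the enlarged set. *)
Lemma complete_minor_contract k adj S x y : symmetric adj -> x \in S ->
  y \in S -> adj x y -> complete_minor k (contract adj x y) (S :\ y) ->
  complete_minor k adj S.
Proof.
move=> sym xS yS xy [B [r [rB BS disB con]]].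
pose ext (A : {set V}) := if x \in A then y |: A else A.
have extS (A : {set V}) : A \subset ext A by rewrite /ext; case: ifP => // _; exact: subsetUr.
have yB i : y \notin B i.
  by apply/negP => /(subsetP (BS i)); rewrite !inE eqxx.
exists (fun i => ext (B i)), r; split.
- by move=> i; apply: (subsetP (extS _)).
- move=> i; rewrite /ext; case: ifP => _.
    by rewrite subUset sub1set yS (subset_trans (BS i))// subD1set.
  by rewrite (subset_trans (BS i))// subD1set.
- move=> i j ij; have dij := disB i j ij.
  have H k1 k2 : k1 != k2 -> x \in B k1 -> x \notin B k2.
    move=> k12 xk; have := disB _ _ k12.
    by rewrite disjoint_subset => /subsetP /(_ _ xk).
  rewrite /ext; case: ifP => xi; case: ifP => xj //.
  + by have := H _ _ ij xi; rewrite xj.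
  + by rewrite -setI_eq0 setIUl setU_eq0 !setI_eq0 disjoints1 yB.
  + by rewrite -setI_eq0 setIUr setU_eq0 !setI_eq0 disjoint_sym disjoints1 yB.
- move=> i j ij; apply: connect_sub (con i j ij).
  move=> a b /=; set U := B i :|: B j; set U' := ext (B i) :|: ext (B j).
  move=> /and3P[+ aU bU].
  have UU' : U \subset U' by rewrite setUSS// extS.
  have aU' := subsetP UU' _ aU; have bU' := subsetP UU' _ bU.
  have xy' : x \in U -> y \in U'.
    rewrite !inE /ext => /orP[] ->; rewrite !inE eqxx ?orbT//.
  move=> /andP[_ /or3P[ab|/andP[/eqP ax yb]|/andP[/eqP bx ay]]].
  + by apply: connect1; rewrite /= ab aU'.
  + have yU : y \in U' by apply: xy'; rewrite -ax.
    apply: (connect_trans (y := y)); apply: connect1 => /=.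
      by rewrite ax xy -ax aU'.
    by rewrite yb yU.
  + have yU : y \in U' by apply: xy'; rewrite -bx.
    apply: (connect_trans (y := y)); apply: connect1 => /=.
      by rewrite ay aU'.
    by rewrite bx sym xy yU -bx.
Qed.

(** All the branch sets lie in the neighbourhood of [x], so the singleton of [x] is one more branch
    set, adjacent to every root. *)
Lemma complete_minor_cone k adj S x : symmetric adj -> irreflexive adj ->
  x \in S -> complete_minor k adj [set b in S | adj x b] ->
  complete_minor k.+1 adj S.
Proof.
move=> sym irr xS [B [r [rB BS disB con]]].
have xB i : x \notin B i.
  by apply/negP => /(subsetP (BS i)); rewrite inE irr andbF.
have adjr i : adj x (r i).
  by have := subsetP (BS i) _ (rB i); rewrite inE => /andP[].
exists (fun i => if unlift ord0 i is Some j then B j else [set x]),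
  (fun i => if unlift ord0 i is Some j then r j else x); split.
- by move=> i; case: unliftP => [j|] _; rewrite ?set11.
- move=> i; case: unliftP => [j|] _; last by rewrite sub1set.
  by rewrite (subset_trans (BS j))//; apply/subsetP => b; rewrite inE => /andP[].
- move=> i j; case: unliftP => [i'|] ->; case: unliftP => [j'|] -> //.
  + by rewrite (inj_eq lift_inj); exact: disB.
  + by move=> _; rewrite disjoint_sym disjoints1.
  + by move=> _; rewrite disjoints1.
- move=> i j; case: unliftP => [i'|] ->; case: unliftP => [j'|] -> //.
  + by rewrite (inj_eq lift_inj); exact: con.
  + by move=> _; apply: connect1; rewrite /= sym adjr !inE rB eqxx orbT.
  + by move=> _; apply: connect1; rewrite /= adjr !inE rB eqxx !orbT.
Qed.

(* Mader's argument: either some edge can be contracted without lowering the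
   density, or every edge lies in many triangles and then a neighbourhood is
   dense. *)
Lemma dense_complete_minor k adj S : symmetric adj -> irreflexive adj ->
  S != set0 -> 2 ^ k * #|S| <= arcs_in adj S -> complete_minor k.+2 adj S.
Proof.
elim: k adj S => [|k IHk] adj S.
  rewrite expn0 mul1n => sym irr S0 le.
  have : 0 < arcs_in adj S by rewrite (leq_trans _ le)// card_gt0.
  rewrite lt0n sum_nat_eq0 negb_forall => /existsP[a].
  rewrite negb_imply sum_nat_eq0 negb_forall => /andP[aS /existsP[b]].
  rewrite negb_imply => /andP[bS]; rewrite eqb0 negbK => ab.
  have nab : a != b by apply: contraTneq ab => ->; rewrite irr.
  pose r (i : 'I_2) := if i == ord0 then a else b.
  exists (fun i => [set r i]), r; split.
  - by move=> i; rewrite set11.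
  - by move=> i; rewrite sub1set /r; case: ifP.
  - move=> i j ij; rewrite disjoints1 inE /r.
    move: ij nab; case: (i =P ord0) => [->|/eqP i0]; case: (j =P ord0) => [->|/eqP j0] //.
      by move=> _; rewrite eq_sym.
    by case: i j i0 j0 => [[|[|i]]//= ?] [[|[|j]]//= ?].
  - move=> i j ij; apply: connect1; rewrite /= !inE !eqxx orbT /= andbT /r.
    move: ij; case: (i =P ord0) => [->|/eqP i0]; case: (j =P ord0) => [->|/eqP j0] //.
      by rewrite sym.
    by case: i j i0 j0 => [[|[|i]]//= ?] [[|[|j]]//= ?].
(* Contraction keeps [k] and lowers the size of [S]; passing to a neighbourhood lowers [k]. Hence an
   induction on the size inside the one on [k]. *)
have [n] := ubnP #|S|; elim: n => // n IHn in adj S *.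
rewrite ltnS => cS sym irr S0 le.
have [/existsP[[x y] /= /and4P[xS yS xy dense]]|none] := boolP [exists e : V * V,
  [&& e.1 \in S, e.2 \in S, adj e.1 e.2 &
   2 ^ k.+1 * #|S :\ e.2| <= arcs_in (contract adj e.1 e.2) (S :\ e.2)]].
  have cSy : #|S| = #|S :\ y|.+1 by rewrite (cardsD1 y) yS.
  apply: (complete_minor_contract sym xS yS xy).
  apply: IHn => //; first by rewrite -ltnS -cSy.
  - exact: contract_sym.
  - exact: contract_irr.
  - apply/set0Pn; exists x; rewrite !inE xS andbT.
    by apply: contraTneq xy => ->; rewrite irr.
(* Deleting one vertex lowers the required number of arcs by [2 ^ k.+1]. As contracting [x y] breaks
   the density, it must lose more than that, and the loss is twice the number of triangles plus
   2. *)
have common x y : x \in S -> y \in S -> adj x y ->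
    2 ^ k <= \sum_(b in S) (adj x b && adj y b).
  move=> xS yS xy; have := arcs_in_contract sym irr xS yS xy.
  move: none; rewrite negb_exists => /forallP /(_ (x, y)) /=.
  rewrite xS yS xy /= -ltnNge => lt eqE.
  move: le; rewrite eqE (cardsD1 y S) yS expnS mulnDr muln1.
  move: lt; rewrite expnS; lia.
have : 0 < arcs_in adj S.
  by rewrite (leq_trans _ le)// muln_gt0 expn_gt0 card_gt0.
rewrite lt0n sum_nat_eq0 negb_forall => /existsP[x].
rewrite negb_imply sum_nat_eq0 negb_forall => /andP[xS /existsP[y]].
rewrite negb_imply => /andP[yS]; rewrite eqb0 negbK => xy.
apply: (complete_minor_cone (x := x)) => //; apply: IHk => //.
  by apply/set0Pn; exists y; rewrite inE yS.
(* For [z] in the neighbourhood of [x], the third vertices of the triangles on [x z] are the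
   neighbours of [z] inside that neighbourhood. *)
rewrite mulnC -sum_nat_const; apply: leq_sum => z; rewrite inE => /andP[zS xz].
rewrite (leq_trans (common _ _ xS zS xz))// [leqRHS]big_mkcond.
rewrite [leqLHS]big_mkcond /=; apply: leq_sum => b _.
by rewrite inE; case: (b \in S); case: (adj x b).
Qed.

End DenseMinors.

(** * Van Kampen's obstruction for K5 *)

Section VanKampen.
Variables (V : finType) (adj : rel V) (u : V -> V -> bool).
Variable w : V -> V -> V -> bool.
Hypothesis u_anti : forall x y, x != y -> u y x = ~~ u x y.
(* [w c a b] plays the role of the winding parity of the edge [ab] around [c] *)
Hypothesis w_rel : forall a b c d, adj a b -> adj c d ->
  a != c -> a != d -> b != c -> b != d ->
  w c a b (+) w d a b =
  (w a c d (+) w b c d) (+) ((u c a (+) u d a) (+) (u c b (+) u d b)).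

Fixpoint walk_winding (v x : V) (p : seq V) : bool :=
  if p is y :: p' then w v x y (+) walk_winding v y p' else false.

Lemma edge_walk_relation a b c q : adj a b -> path adj c q ->
  a \notin c :: q -> b \notin c :: q ->
  w c a b (+) w (last c q) a b =
  (walk_winding a c q (+) walk_winding b c q) (+)
  ((u c a (+) u (last c q) a) (+) (u c b (+) u (last c q) b)).
Proof.
move=> ab; elim: q c => [|d q IH] c /=; first by rewrite !addbb.
move=> /andP[cd dq]; rewrite !(inE, negb_or).
move=> /and3P[ac ad aq] /and3P[bc bd bq].
have H1 := w_rel ab cd ac ad bc bd.
have H2 := IH d dq; rewrite !(inE, negb_or) ad aq bd bq in H2.
have -> : w c a b (+) w (last d q) a b =
  (w c a b (+) w d a b) (+) (w d a b (+) w (last d q) a b).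
  by rewrite addbA addbK.
rewrite H1 H2// addbACA; congr (_ (+) _); first by rewrite addbACA.
move: (u c a) (u d a) (u c b) (u d b) (u (last d q) a) (u (last d q) b).
by do 6 case.
Qed.

(** The same cancellation along the first walk. Disjointness of the two walks makes every pair of
    their edges independent. *)
Lemma walk_walk_relation a p c q : path adj a p -> path adj c q ->
  [disjoint a :: p & c :: q] ->
  walk_winding c a p (+) walk_winding (last c q) a p =
  (walk_winding a c q (+) walk_winding (last a p) c q) (+)
  ((u c a (+) u (last c q) a) (+) (u c (last a p) (+) u (last c q) (last a p))).
Proof.
move=> + cq; elim: p a => [|b p IH] a /=; first by rewrite !addbb.
move=> /andP[ab bp]; rewrite disjoint_cons => /andP[aq dis].
have H2 := IH b bp dis; move: dis; rewrite disjoint_cons => /andP[bq _].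
have H1 := edge_walk_relation ab cq aq bq.
rewrite addbACA H1 H2 addbACA; congr (_ (+) _).
  by rewrite addbA addbK.
move: (u c a) (u (last c q) a) (u c b) (u (last c q) b) (u c (last b p)).
by move: (u (last c q) (last b p)); do 6 case.
Qed.

(** Walks between the roots play the part of the edges of [K_5]. Walks with four distinct ends run
    in disjoint unions of branch sets, so the relation holds for each of the 15 pairs of independent
    edges, and these relations are inconsistent modulo 2. *)
Lemma no_complete_minor5 S : ~ complete_minor 5 adj S.
Proof.
move=> [B [r [rB _ disB con]]].
have : forall ij : 'I_5 * 'I_5, exists p, ij.1 != ij.2 ->
  [/\ path adj (r ij.1) p, last (r ij.1) p = r ij.2 &
      {subset r ij.1 :: p <= B ij.1 :|: B ij.2}].
  move=> [i j] /=; have [->|ij] := eqVneq i j; first by exists [::].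
  have /connectP[p pp lp] := con i j ij; exists p => _; split=> //.
    by apply: sub_path pp => a b /= /andP[].
  move=> z; rewrite inE => /predU1P[->|]; first by rewrite inE rB.
  elim: p (r i) pp {lp} => // b p IH a /= /andP[/and3P[_ _ bU] pp].
  by rewrite inE => /predU1P[-> //|]; exact: IH pp.
move=> /fin_all_exists[P HP].
pose W k i j := walk_winding (r k) (r i) (P (i, j)).
pose U i j := u (r i) (r j).
have rel i j k l : i != j -> k != l -> i != k -> i != l -> j != k -> j != l ->
    (W k i j (+) W l i j) (+) (W i k l (+) W j k l) (+)
    ((U k i (+) U l i) (+) (U k j (+) U l j)) = false.
  move=> ij kl ik il jk jl.
  have [pij lij sij] := HP (i, j) ij; have [pkl lkl skl] := HP (k, l) kl.
  have := @walk_walk_relation (r i) (P (i, j)) (r k) (P (k, l)) pij pkl.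
  rewrite /W /U lij lkl /= => -> ; first by rewrite -addbA addbb.
  rewrite disjoint_subset; apply/subsetP => z /sij zij.
  rewrite inE; apply/negP => /skl zkl.
  have dis a b : a != b -> z \in B a -> z \in B b -> False.
    move=> ab za zb; have := disB _ _ ab.
    by rewrite disjoint_subset => /subsetP /(_ _ za); rewrite inE zb.
  move: zij zkl; rewrite !inE => /orP[]zi /orP[]zj; first [exact: (dis i k)
    | exact: (dis i l) | exact: (dis j k) | exact: (dis j l)].
have Ua i j : i != j -> U j i = ~~ U i j.
  move=> ij; apply: u_anti; apply: contraTneq (rB i) => ->.
  have := disB _ _ ij; rewrite disjoint_sym disjoint_subset.
  by move=> /subsetP /(_ _ (rB j)).
pose E i j k l := (W k i j (+) W l i j) (+) (W i k l (+) W j k l) (+)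
    ((U k i (+) U l i) (+) (U k j (+) U l j)).
pose o0 := @Ordinal 5 0 isT; pose o1 := @Ordinal 5 1 isT.
pose o2 := @Ordinal 5 2 isT; pose o3 := @Ordinal 5 3 isT.
pose o4 := @Ordinal 5 4 isT.
(* From here on [bool] is the field with two elements, and every comparison is oriented by
   increasing indices at the cost of a constant 1. *)
have Uo (i j : 'I_5) : (i < j)%N -> U j i = 1 + U i j :> bool.
  by move=> ij; rewrite Ua// -val_eqE /= ltn_eqF.
have :
  E o0 o1 o2 o3 + E o0 o1 o2 o4 + E o0 o1 o3 o4 + E o0 o2 o1 o3 +
  E o0 o2 o1 o4 + E o0 o2 o3 o4 + E o0 o3 o1 o2 + E o0 o3 o1 o4 +
  E o0 o3 o2 o4 + E o0 o4 o1 o2 + E o0 o4 o1 o3 + E o0 o4 o2 o3 +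
  E o1 o2 o3 o4 + E o1 o3 o2 o4 + E o1 o4 o2 o3 = 0 :> bool.
  by rewrite /E !rel.
have addE (x y : bool) : x (+) y = x + y by [].
rewrite /E !addE !(
  (@Uo o0 o1 isT), (@Uo o0 o2 isT), (@Uo o0 o3 isT), (@Uo o0 o4 isT),
  (@Uo o1 o2 isT), (@Uo o1 o3 isT), (@Uo o1 o4 isT), (@Uo o2 o3 isT),
  (@Uo o2 o4 isT), (@Uo o3 o4 isT)).
(* [ring] works over the integers here and does not cancel [Y + Y], so half of the sum is written
   out. Each [W] occurs in 2 relations and each pair of roots in 6. Four indices [a < b < c < d]
   give 4, 3 and 2 reversed comparisons for their three pairings, so 9 for each of the five
   quadruples: 45, that is [1 + 2 * 22]. *)
pose Y : bool :=
  W o0 o1 o2 + W o0 o1 o3 + W o0 o1 o4 + W o0 o2 o3 + W o0 o2 o4 +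
  W o0 o3 o4 + W o1 o0 o2 + W o1 o0 o3 + W o1 o0 o4 + W o1 o2 o3 +
  W o1 o2 o4 + W o1 o3 o4 + W o2 o0 o1 + W o2 o0 o3 + W o2 o0 o4 +
  W o2 o1 o3 + W o2 o1 o4 + W o2 o3 o4 + W o3 o0 o1 + W o3 o0 o2 +
  W o3 o0 o4 + W o3 o1 o2 + W o3 o1 o4 + W o3 o2 o4 + W o4 o0 o1 +
  W o4 o0 o2 + W o4 o0 o3 + W o4 o1 o2 + W o4 o1 o3 + W o4 o2 o3
  + 3%:R * (
    U o0 o1 + U o0 o2 + U o0 o3 + U o0 o4 + U o1 o2 + U o1 o3 + U o1 o4 +
    U o2 o3 + U o2 o4 + U o3 o4)
  + 22%:R.
set z := (X in X = _) => z0.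
have : z = 1 + (Y + Y) by rewrite /z /Y; ring.
have YY : Y + Y = 0 by exact: addbb.
by rewrite z0 YY.
Qed.

End VanKampen.

(** * Intervals of the nodes of a tree *)

Section TreeIntervals.
Local Open Scope nat_scope.
Variables (T : finType) (e : rel T) (r : T).
Hypothesis e_fun : forall x y z, e x y -> e x z -> y = z.
Hypothesis e_root : forall y, ~~ e r y.
Hypothesis e_conn : forall x, connect e x r.

Lemma connectE x y : connect e x y = (x == y) || [exists z, e x z && connect e z y].
Proof.
apply/idP/idP => [/connectP[[|z p] /=]|].
- by move=> _ ->; rewrite eqxx.
- move=> /andP[xz zp] ->; apply/orP; right; apply/existsP; exists z.
  by rewrite xz; apply/connectP; exists p.
- move=> /predU1P[->|/existsP[z /andP[xz zy]]]; first exact: connect0.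
  exact: connect_trans (connect1 xz) zy.
Qed.

(** Since parents are unique, a walk that starts on a cycle through [x] can always be continued back
    to [x]. The walk from [x] to the root would then leave the root. *)
Lemma tree_acyclic x z : e x z -> ~~ connect e z x.
Proof.
move=> xz; apply/negP => zx.
have back p : path e x p -> connect e (last x p) x.
  elim/last_ind: p => [|p w IH]; first by rewrite connect0.
  rewrite rcons_path last_rcons => /andP[/IH + lw].
  rewrite connectE => /predU1P[lx|/existsP[y /andP[ly yx]]].
    by rewrite lx in lw; rewrite (e_fun lw xz).
  by rewrite (e_fun lw ly).
have /connectP[p xp rE] := e_conn x.
have := back p xp; rewrite -rE connectE => /predU1P[rx|/existsP[y /andP[ry _]]].
  by rewrite -rx in xz; have := e_root z; rewrite xz.
by have := e_root y; rewrite ry.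
Qed.

Lemma tree_parent x : x != r -> exists z, e x z.
Proof.
move=> xr; have := e_conn x.
by rewrite connectE (negPf xr) => /existsP[z /andP[]]; exists z.
Qed.

Lemma connect_parent x z y : e x z -> connect e x y = (x == y) || connect e z y.
Proof.
move=> xz; rewrite connectE; congr (_ || _).
apply/existsP/idP => [[w /andP[xw wy]]|zy]; first by rewrite (e_fun xz xw).
by exists z; rewrite xz.
Qed.

Lemma tree_anti x y : connect e x y -> connect e y x -> x = y.
Proof.
rewrite connectE => /predU1P[//|/existsP[z /andP[xz zy]]] yx.
by have := tree_acyclic xz; rewrite (connect_trans zy yx).
Qed.

(** Uniqueness of parents makes the ancestors of [x] a chain. *)
Lemma tree_linear x y y' : connect e x y -> connect e x y' ->
  connect e y y' || connect e y' y.
Proof.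
move=> /connectP[p xp ->] {y}; elim: p x xp => [|z p IH] x /=; first by move=> _ ->.
move=> /andP[xz zp]; rewrite (connect_parent _ xz) => /predU1P[<-|]; last exact: IH.
apply/orP; right; apply: connect_trans (connect1 xz) _.
by apply/connectP; exists p.
Qed.

(** A node is counted among its own ancestors, so the root has depth 1. *)
Definition depth x := #|[set y | connect e x y]|.

Lemma depth_le x : depth x <= #|T|.
Proof. exact: max_card. Qed.

Lemma depth_parent x z : e x z -> depth x = (depth z).+1.
Proof.
move=> xz; rewrite /depth (_ : [set y | connect e x y] = x |: [set y | connect e z y]).
  by rewrite cardsU1 inE tree_acyclic.
by apply/setP => y; rewrite !inE (connect_parent _ xz) eq_sym.
Qed.

Lemma depth_lt x y : connect e x y -> x != y -> depth y < depth x.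
Proof.
move=> xy nxy; apply: proper_card; apply/properP; split.
  by apply/subsetP => z; rewrite !inE => yz; exact: connect_trans xy yz.
exists x; rewrite inE ?connect0//; apply: contraNN nxy => yx.
by rewrite (tree_anti xy yx).
Qed.

Variables (idx : T -> nat) (B M : nat).
Hypothesis idx_inj : injective idx.
Hypothesis idx_lt : forall x, idx x < #|T|.
Hypothesis B_large : 2 * #|T| + 2 <= B.
Hypothesis M_large : #|T| < M.

(* The interval of a node has the path from the root as its base [B] digits;
   odd digits keep the intervals of siblings apart. *)
Definition ileft x := \sum_(y | connect e x y) (2 * idx y + 1) * B ^ (M - depth y).
Definition iwidth x := B ^ (M - depth x).

Lemma iwidth_gt0 x : 0 < iwidth x.
Proof. by rewrite expn_gt0; apply/orP; left; lia. Qed.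

(** [M] exceeds every depth, so even the narrowest interval has width at least [B]. This is the room
    for the strip of oblique segments at a vertex. *)
Lemma iwidth_ge x : B <= iwidth x.
Proof.
have dM : 0 < M - depth x by rewrite subn_gt0 (leq_ltn_trans (depth_le x)).
by rewrite /iwidth -{1}(expn1 B) leq_exp2l//; lia.
Qed.

Lemma iwidth_parent x z : e x z -> iwidth z = B * iwidth x.
Proof.
move=> xz; rewrite /iwidth -expnS (depth_parent xz); congr (_ ^ _).
by have := depth_le x; rewrite (depth_parent xz); lia.
Qed.

Lemma ileft_parent x z : e x z -> ileft x = ileft z + (2 * idx x + 1) * iwidth x.
Proof.
move=> xz; rewrite /ileft (bigD1 x) ?connect0//= addnC; congr (_ + _).
apply: eq_bigl => y; rewrite (connect_parent _ xz).
case: (eqVneq y x) => [->|_] /=; last by rewrite andbT.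
by rewrite (negPf (tree_acyclic xz)).
Qed.

(** In units of the width of [x], the child occupies from [2 * idx x + 1] to [2 * idx x + 2] inside
    an interval of length [B], and both numbers lie strictly between 0 and [B]. *)
Lemma nested_parent x z : e x z ->
  ileft z < ileft x /\ ileft x + iwidth x < ileft z + iwidth z.
Proof.
move=> xz; rewrite (iwidth_parent xz) (ileft_parent xz).
have := iwidth_gt0 x; have := idx_lt x; move: (iwidth x) (idx x) => w i iT w0.
split; first by rewrite -[ltnLHS]addn0 ltn_add2l; nia.
by rewrite -addnA ltn_add2l; nia.
Qed.

Lemma nested x y : connect e x y -> x != y ->
  ileft y < ileft x /\ ileft x + iwidth x < ileft y + iwidth y.
Proof.
move=> /connectP[p]; elim: p x => [|z p IH] x /=; first by move=> _ ->; rewrite eqxx.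
move=> /andP[xz zp] yE nxy; have [h1 h2] := nested_parent xz.
have [zy|nzy] := eqVneq z y; first by rewrite -zy.
by have [h3 h4] := IH z zp yE nzy; split; lia.
Qed.

(** Induction on the sum of the depths. While a node may be replaced by its parent without becoming
    comparable to the other one, nesting carries the separation down from the parent. Otherwise the
    two nodes are siblings, and their odd digits differ by at least 2 while each interval has width
    1 in the same unit. *)
Lemma separated_intervals x y : ~~ connect e x y -> ~~ connect e y x ->
  (ileft x + iwidth x < ileft y) || (ileft y + iwidth y < ileft x).
Proof.
have [n] := ubnP (depth x + depth y).
elim: n => // n IH in x y *; rewrite ltnS => dn nxy nyx.
have xr : x != r by apply: contraNneq nyx => ->; exact: e_conn.
have yr : y != r by apply: contraNneq nxy => ->; exact: e_conn.
have [z xz] := tree_parent xr; have [w yw] := tree_parent yr.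
have [h1 h2] := nested_parent xz; have [h3 h4] := nested_parent yw.
have dx := depth_parent xz; have dy := depth_parent yw.
have nzy : ~~ connect e z y.
  by move: nxy; rewrite (connect_parent _ xz) negb_or => /andP[].
have nwx : ~~ connect e w x.
  by move: nyx; rewrite (connect_parent _ yw) negb_or => /andP[].
case: (boolP (connect e y z)) => [yz|nyz]; last first.
  have/orP[lt|lt] : (ileft z + iwidth z < ileft y) || (ileft y + iwidth y < ileft z).
    by apply: IH => //; apply: leq_trans dn; rewrite dx.
  - by apply/orP; left; clear -h1 h2 lt; lia.
  - by apply/orP; right; clear -h1 h2 lt; lia.
case: (boolP (connect e x w)) => [xw|nxw]; last first.
  have/orP[lt|lt] : (ileft x + iwidth x < ileft w) || (ileft w + iwidth w < ileft x).
    by apply: IH => //; apply: leq_trans dn; rewrite dy addnS.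
  - by apply/orP; left; clear -h3 h4 lt; lia.
  - by apply/orP; right; clear -h3 h4 lt; lia.
(* Each parent is now an ancestor of the other node, hence of the other parent. *)
have zw : z = w.
  apply: tree_anti.
    move: xw; rewrite (connect_parent _ xz) => /predU1P[xw|//].
    by move: nyx; rewrite xw connect1.
  move: yz; rewrite (connect_parent _ yw) => /predU1P[yz|//].
  by move: nxy; rewrite yz connect1.
subst w; rewrite (ileft_parent xz) (ileft_parent yw).
have wE : iwidth x = iwidth y by rewrite /iwidth dx dy.
have : idx x != idx y.
  by apply: contraNneq nxy => /idx_inj ->; exact: connect0.
rewrite wE; have := iwidth_gt0 y.
move: (iwidth y) (idx x) (idx y) (ileft z) => w i j l w0; clear -w0.
by rewrite neq_ltn => /orP[ij|ij]; apply/orP; [left|right]; rewrite -addnA ltn_add2l; nia.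
Qed.

(** [l] is a deepest common ancestor. Ancestors form a chain, so the common ancestors are exactly
    those of [l]; their number is therefore [depth l], which can be computed without finding [l]. *)
Lemma lowest_common u v : exists l, [/\ connect e u l, connect e v l,
  depth l = #|[set y | connect e u y && connect e v y]| &
  forall y, ~~ (connect e u y && connect e v y) ->
    depth l < depth y \/ ~~ connect e y l /\ ~~ connect e l y].
Proof.
pose P y := connect e u y && connect e v y.
have Pr : P r by rewrite /P !e_conn.
have [l Pl max] := @arg_maxnP _ r P depth Pr.
have /andP[ul vl] := Pl.
have lP y : P y = connect e l y.
  apply/idP/idP => [Py|ly].
    case/andP: (Py) => uy vy.
    case/orP: (tree_linear ul uy) => // yl.
    have [-> //|ne] := eqVneq l y.
    have := depth_lt yl; rewrite eq_sym => /(_ ne); rewrite ltnNge.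
    by have /= -> := max _ Py.
  by rewrite /P (connect_trans ul ly) (connect_trans vl ly).
exists l; split=> //; first by apply: eq_card => y; rewrite !inE -lP.
move=> y; rewrite -/(P y) lP => nly; case: (boolP (connect e y l)) => yl.
  by left; apply: depth_lt => //; apply: contraNneq nly => ->; exact: connect0.
by right.
Qed.

End TreeIntervals.

(** * Computable functions *)

Section Computable.
Local Open Scope nat_scope.

Definition computable (a b : dty) (f : dom a -> dom b) : Prop :=
  exists p : prog a b, forall x, run p x (f x).

(** The functional counterpart of [Plistrec]; [iteri] plays this part for [Pnatrec]. *)
Fixpoint list_rec (A B : Type) (q : A -> seq A -> B -> B) (z : B) (s : seq A) : B :=
  if s is h :: s' then q h s' (list_rec q z s') else z.

Lemma computable_ext a b (f g : dom a -> dom b) :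
  f =1 g -> computable f -> computable g.
Proof. by move=> fg [p pf]; exists p => x; rewrite -fg. Qed.

Lemma computable_comp a b c (g : dom b -> dom c) (f : dom a -> dom b) :
  computable g -> computable f -> @computable a c (fun x => g (f x)).
Proof. by move=> [q qg] [p pf]; exists (Pcomp q p) => x; exists (f x). Qed.

Lemma computable_id a : @computable a a (fun x => x).
Proof. by exists (Pid a). Qed.

Lemma computable_pair a b c (f : dom a -> dom b) (g : dom a -> dom c) :
  computable f -> computable g -> @computable a (Prod b c) (fun x => (f x, g x)).
Proof. by move=> [p pf] [q qg]; exists (Ppair p q). Qed.

Lemma computable_fst a b c (f : dom a -> dom (Prod b c)) :
  computable f -> @computable a b (fun x => (f x).1).
Proof. by apply: (@computable_comp _ (Prod b c)); exists (Pfst b c). Qed.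

Lemma computable_snd a b c (f : dom a -> dom (Prod b c)) :
  computable f -> @computable a c (fun x => (f x).2).
Proof. by apply: (@computable_comp _ (Prod b c)); exists (Psnd b c). Qed.

Lemma computable_succ a (f : dom a -> nat) :
  @computable a Nat f -> @computable a Nat (fun x => (f x).+1).
Proof. by apply: (@computable_comp _ Nat); exists Psucc. Qed.

Lemma computable_const a (k : nat) : @computable a Nat (fun=> k).
Proof. by elim: k => [|k]; [exists (Pzero a) | exact: computable_succ]. Qed.

Lemma computable_nil a b : @computable a (List b) (fun=> [::]).
Proof. by exists (Pnil a b). Qed.

Lemma computable_cons a b (f : dom a -> dom b) (g : dom a -> seq (dom b)) :
  computable f -> @computable a (List b) g ->
  @computable a (List b) (fun x => f x :: g x).
Proof.
move=> cf cg; apply: (@computable_comp a (Prod b (List b)) (List b) (fun x => x.1 :: x.2)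
  (fun x => (f x, g x))).
  by exists (Pcons b).
exact: (@computable_pair _ b (List b)).
Qed.

Lemma computable_iteri a b (m : dom a -> nat) (q : dom a -> nat -> dom b -> dom b)
    (z : dom a -> dom b) :
  @computable a Nat m -> computable z ->
  @computable (Prod a (Prod Nat b)) b (fun t => q t.1 t.2.1 t.2.2) ->
  @computable a b (fun x => iteri (m x) (q x) (z x)).
Proof.
move=> cm [pz hz] [pq hq].
apply: (@computable_comp a (Prod a Nat) b (fun t => iteri t.2 (q t.1) (z t.1))
  (fun x => (x, m x))); last exact: (@computable_pair _ a Nat _ _ (computable_id a)).
exists (Pnatrec pz pq) => -[x n] /=; elim: n => [|n IH] /=; first exact: hz.
by exists (iteri n (q x) (z x)) => //; exact: (hq (x, (n, _))).
Qed.

Lemma computable_list_rec a b c (s : dom a -> seq (dom b))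
    (q : dom a -> dom b -> seq (dom b) -> dom c -> dom c) (z : dom a -> dom c) :
  @computable a (List b) s -> computable z ->
  @computable (Prod a (Prod (Prod b (List b)) c)) c
    (fun t => q t.1 t.2.1.1 t.2.1.2 t.2.2) ->
  @computable a c (fun x => list_rec (q x) (z x) (s x)).
Proof.
move=> cs [pz hz] [pq hq].
apply: (@computable_comp a (Prod a (List b)) c
  (fun t => list_rec (q t.1) (z t.1) t.2) (fun x => (x, s x))); last first.
  exact: (@computable_pair _ a (List b) _ _ (computable_id a)).
exists (Plistrec pz pq) => -[x l] /=; elim: l => [|h l IH] /=; first exact: hz.
by exists (list_rec (q x) (z x) l) => //; exact: (hq (x, ((h, l), _))).
Qed.

Lemma computable_wk a b c (f : dom a -> dom c) :
  computable f -> @computable (Prod a b) c (fun t => f t.1).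
Proof. move=> cf; apply: (@computable_comp (Prod a b) a c f (fun t => t.1)) => //.
by exists (Pfst a b). Qed.

Lemma computable_last a b : @computable (Prod a b) b (fun t => t.2).
Proof. by exists (Psnd a b). Qed.

Lemma computable_index a b : @computable (Prod a (Prod Nat b)) Nat (fun t => t.2.1).
Proof. exact/(@computable_fst _ Nat b)/computable_last. Qed.

Lemma computable_acc a b : @computable (Prod a (Prod Nat b)) b (fun t => t.2.2).
Proof. exact/(@computable_snd _ Nat b)/computable_last. Qed.

Lemma computable_lhead a b c :
  @computable (Prod a (Prod (Prod b (List b)) c)) b (fun t => t.2.1.1).
Proof.
apply/(@computable_fst _ b (List b))/(@computable_fst _ (Prod b (List b)) c).
exact: computable_last.
Qed.

Lemma computable_ltail a b c :
  @computable (Prod a (Prod (Prod b (List b)) c)) (List b) (fun t => t.2.1.2).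
Proof.
apply/(@computable_snd _ b (List b))/(@computable_fst _ (Prod b (List b)) c).
exact: computable_last.
Qed.

Lemma computable_lacc a b c :
  @computable (Prod a (Prod (Prod b (List b)) c)) c (fun t => t.2.2).
Proof. exact/(@computable_snd _ (Prod b (List b)) c)/computable_last. Qed.

Lemma computable_add a (f g : dom a -> nat) : @computable a Nat f -> @computable a Nat g ->
  @computable a Nat (fun x => f x + g x).
Proof.
move=> cf cg.
apply: (@computable_ext _ Nat (fun x => iteri (g x) (fun _ y => y.+1) (f x))).
  by move=> x; elim: (g x) => [|n /= ->]; rewrite ?addn0 ?addnS.
apply: (@computable_iteri a Nat g (fun _ _ y => y.+1)) => //.
exact/computable_succ/(computable_acc a Nat).
Qed.

Lemma computable_pred a (f : dom a -> nat) :
  @computable a Nat f -> @computable a Nat (fun x => (f x).-1).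
Proof.
(* The last index visited by the iteration is the predecessor, with value 0 when there is none. *)
move=> cf; apply: (@computable_ext _ Nat (fun x => iteri (f x) (fun i _ => i) 0)).
  by move=> x; case: (f x).
apply: (@computable_iteri a Nat f (fun _ i _ => i) (fun=> 0)) => //.
  exact: computable_const.
exact: (computable_index a Nat).
Qed.

Lemma computable_if0 a b (f : dom a -> nat) (g h : dom a -> dom b) : @computable a Nat f ->
  computable g -> computable h ->
  @computable a b (fun x => if f x == 0 then g x else h x).
Proof.
move=> cf cg ch.
(* A conditional is an iteration that overwrites its accumulator: zero rounds leave [g x], any
   positive number of them leaves [h x]. *)
apply: (@computable_ext _ b (fun x => iteri (f x) (fun _ _ => h x) (g x))).
  by move=> x; case: (f x).
apply: (@computable_iteri a b f (fun x _ _ => h x)) => //.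
exact: computable_wk.
Qed.

Lemma computable_mul a (f g : dom a -> nat) : @computable a Nat f -> @computable a Nat g ->
  @computable a Nat (fun x => f x * g x).
Proof.
move=> cf cg.
apply: (@computable_ext _ Nat (fun x => iteri (g x) (fun _ y => y + f x) 0)).
  by move=> x; elim: (g x) => [|n /= ->]; rewrite ?muln0 ?mulnSr.
apply: (@computable_iteri a Nat g (fun x _ y => y + f x) (fun=> 0)) => //.
  exact: computable_const.
by apply: computable_add; [exact: (computable_acc a Nat) | exact: computable_wk].
Qed.

Lemma computable_exp a (f g : dom a -> nat) : @computable a Nat f -> @computable a Nat g ->
  @computable a Nat (fun x => f x ^ g x).
Proof.
move=> cf cg.
apply: (@computable_ext _ Nat (fun x => iteri (g x) (fun _ y => y * f x) 1)).
  by move=> x; elim: (g x) => [|n /= ->]; rewrite ?expnSr.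
apply: (@computable_iteri a Nat g (fun x _ y => y * f x) (fun=> 1)) => //.
  exact: computable_const.
by apply: computable_mul; [exact: (computable_acc a Nat) | exact: computable_wk].
Qed.

Lemma computable_sub a (f g : dom a -> nat) : @computable a Nat f -> @computable a Nat g ->
  @computable a Nat (fun x => f x - g x).
Proof.
move=> cf cg.
apply: (@computable_ext _ Nat (fun x => iteri (g x) (fun _ y => y.-1) (f x))).
  by move=> x; elim: (g x) => [|n /= ->]; rewrite ?subn0 ?subnS.
apply: (@computable_iteri a Nat g (fun _ _ y => y.-1)) => //.
exact/computable_pred/(computable_acc a Nat).
Qed.

Lemma computable_pos a (f : dom a -> nat) : @computable a Nat f ->
  @computable a Nat (fun x => (0 < f x : nat)).
Proof.
move=> cf; apply: (@computable_ext _ Nat (fun x => if f x == 0 then 0 else 1)).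
  by move=> x; case: (f x).
by apply: (@computable_if0 a Nat) => //; exact: computable_const.
Qed.

Lemma computable_eqn a (f g : dom a -> nat) : @computable a Nat f -> @computable a Nat g ->
  @computable a Nat (fun x => (f x == g x : nat)).
Proof.
move=> cf cg; apply: (@computable_ext _ Nat
  (fun x => if (f x - g x) + (g x - f x) == 0 then 1 else 0)).
  by move=> x; rewrite addn_eq0 !subn_eq0 -eqn_leq; case: eqP.
apply: (@computable_if0 a Nat); try exact: computable_const.
by apply: computable_add; exact: computable_sub.
Qed.

Lemma computable_sum a (f : dom a -> nat) (F : dom a -> nat -> nat) : @computable a Nat f ->
  @computable (Prod a Nat) Nat (fun t => F t.1 t.2) ->
  @computable a Nat (fun x => \sum_(i < f x) F x i).
Proof.
move=> cf cF.
apply: (@computable_ext _ Nat (fun x => iteri (f x) (fun i y => y + F x i) 0)).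
  by move=> x; elim: (f x) => [|n /= ->]; rewrite ?big_ord0 ?big_ord_recr.
apply: (@computable_iteri a Nat f (fun x i y => y + F x i) (fun=> 0)) => //.
  exact: computable_const.
apply: computable_add; first exact: (computable_acc a Nat).
apply: (@computable_comp (Prod a (Prod Nat Nat)) (Prod a Nat) Nat
  (fun t => F t.1 t.2) (fun t => (t.1, t.2.1))) => //.
apply: (@computable_pair _ a Nat); last exact: (computable_index a Nat).
exact: (@computable_wk a (Prod Nat Nat) a _ (computable_id a)).
Qed.

Lemma computable_iter a b (f : dom a -> nat) (F : dom a -> dom b -> dom b) (z : dom a -> dom b) :
  @computable a Nat f -> computable z ->
  @computable (Prod a b) b (fun t => F t.1 t.2) ->
  @computable a b (fun x => iter (f x) (F x) (z x)).
Proof.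
move=> cf cz cF; apply: (@computable_ext _ b (fun x => iteri (f x) (fun _ => F x) (z x))).
  by move=> x; elim: (f x) => //= n ->.
apply: (@computable_iteri a b f (fun x _ => F x) z) => //.
apply: (@computable_comp (Prod a (Prod Nat b)) (Prod a b) b
  (fun t => F t.1 t.2) (fun t => (t.1, t.2.2))) => //.
apply: (@computable_pair _ a b); last exact: computable_acc.
exact: (@computable_wk a (Prod Nat b) a _ (computable_id a)).
Qed.

Lemma computable_size a b (s : dom a -> seq (dom b)) : @computable a (List b) s ->
  @computable a Nat (fun x => size (s x)).
Proof.
move=> cs; apply: (@computable_ext _ Nat (fun x => list_rec (fun _ _ y => y.+1) 0 (s x))).
  by move=> x; elim: (s x) => //= ? ? ->.
apply: (@computable_list_rec a b Nat s (fun _ _ _ y => y.+1) (fun=> 0)) => //.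
  exact: computable_const.
exact/computable_succ/(computable_lacc a b Nat).
Qed.

Lemma computable_nth a (s : dom a -> seq nat) (f : dom a -> nat) : @computable a (List Nat) s ->
  @computable a Nat f -> @computable a Nat (fun x => nth 0 (s x) (f x)).
Proof.
(* The tail is taken [f x] times, then the head, both by recursions that ignore their
   accumulator. *)
move=> cs cf; apply: (@computable_ext _ Nat (fun x => list_rec (fun h _ _ => h) 0
  (iter (f x) (fun t => list_rec (fun _ s' _ => s') [::] t) (s x)))).
  move=> x; elim: (f x) (s x) => [|n IH] l; first by case: l.
  rewrite iterSr IH; case: l => //=; exact: nth_nil.
apply: (@computable_list_rec a Nat Nat _ (fun _ h _ _ => h) (fun=> 0)).
- apply: (@computable_iter a (List Nat) f (fun _ t => list_rec (fun _ s' _ => s') [::] t)) => //.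
  apply: (@computable_list_rec (Prod a (List Nat)) Nat (List Nat) (fun t => t.2)
    (fun _ _ s' _ => s') (fun=> [::])); first exact: (computable_last a (List Nat)).
    exact: computable_nil.
  exact: (computable_ltail (Prod a (List Nat)) Nat (List Nat)).
- exact: computable_const.
- exact: (computable_lhead a Nat Nat).
Qed.

Lemma computable_mkseq a b (f : dom a -> nat) (F : dom a -> nat -> dom b) : @computable a Nat f ->
  @computable (Prod a Nat) b (fun t => F t.1 t.2) ->
  @computable a (List b) (fun x => mkseq (F x) (f x)).
Proof.
(* Lists grow at the head, so round [i] produces the entry of index [f x - i.+1]. *)
move=> cf cF; apply: (@computable_ext _ (List b)
  (fun x => iteri (f x) (fun i s => F x (f x - i.+1) :: s) [::])).
  move=> x; have : forall n, n <= f x ->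
      iteri n (fun i s => F x (f x - i.+1) :: s) [::] = map (F x) (iota (f x - n) n).
    elim=> [//|n IH] nf; rewrite /= IH; last exact: ltnW.
    by rewrite subnSK.
  by move=> ->//; rewrite subnn.
apply: (@computable_iteri a (List b) f (fun x i s => F x (f x - i.+1) :: s) (fun=> [::])) => //.
  exact: computable_nil.
apply: (@computable_cons _ b); last exact: (computable_acc a (List b)).
apply: (@computable_comp (Prod a (Prod Nat (List b))) (Prod a Nat) b (fun t => F t.1 t.2)
  (fun t => (t.1, f t.1 - t.2.1.+1))) => //.
apply: (@computable_pair _ a Nat).
  exact: (@computable_wk a (Prod Nat (List b)) a _ (computable_id a)).
apply: computable_sub; first exact: computable_wk.
exact/computable_succ/(computable_index a (List b)).
Qed.

(* The second argument of [F] counts down the positions of the list. *)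
Definition map_rank (A B : Type) (F : A -> nat -> B) (s : seq A) : seq B :=
  list_rec (fun h s' r => F h (size s').+1 :: r) [::] s.

Lemma computable_map_rank a b c (s : dom a -> seq (dom b))
    (F : dom a -> dom b -> nat -> dom c) : @computable a (List b) s ->
  @computable (Prod (Prod a b) Nat) c (fun t => F t.1.1 t.1.2 t.2) ->
  @computable a (List c) (fun x => map_rank (F x) (s x)).
Proof.
move=> cs cF.
apply: (@computable_list_rec a b (List c) s
  (fun x h s' r => F x h (size s').+1 :: r) (fun=> [::])) => //.
  exact: computable_nil.
apply: (@computable_cons _ c); last exact: (computable_lacc a b (List c)).
apply: (@computable_comp (Prod a (Prod (Prod b (List b)) (List c)))
  (Prod (Prod a b) Nat) c (fun t => F t.1.1 t.1.2 t.2)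
  (fun t => ((t.1, t.2.1.1), (size t.2.1.2).+1))) => //.
apply: (@computable_pair _ (Prod a b) Nat).
  apply: (@computable_pair _ a b); last exact: (computable_lhead a b (List c)).
  exact: (@computable_wk a (Prod (Prod b (List b)) (List c)) a _ (computable_id a)).
exact/computable_succ/(@computable_size _ b _)/(computable_ltail a b (List c)).
Qed.

End Computable.

(** * The algorithm *)

Section Algorithm.
Local Open Scope nat_scope.

Definition in_verts (x : dom input_ty) : nat := x.1.1.
Definition in_clus (x : dom input_ty) : nat := x.1.2.
Definition in_edges (x : dom input_ty) : seq (nat * nat) := x.2.1.
Definition in_parents (x : dom input_ty) : seq nat := x.2.2.
Definition in_nodes x := in_verts x + in_clus x.
Definition in_size x := size (in_edges x).

(* Node [i] is represented by [i.+1], and [0] stands for no node. *)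
Definition in_up x t := if t == 0 then 0 else
  if nth 0 (in_parents x) t.-1 == 0 then 0
  else in_verts x + nth 0 (in_parents x) t.-1.

(** The bounded sum acts as an existential quantifier over the number of steps from [i] up to [j].
    Fewer steps than there are nodes always suffice in a tree. *)
Definition in_anc x j i : nat :=
  0 < \sum_(d < in_nodes x) (iter d (in_up x) i.+1 == j.+1).
Definition in_depth x i := \sum_(j < in_nodes x) in_anc x j i.
Definition in_common x i i' := \sum_(j < in_nodes x) in_anc x j i * in_anc x j i'.
(** The first two terms give room for the odd digits. The product bounds rank times height: a rank
    is at most [in_size x], a height less than [(in_nodes x).+1 * (in_size x).+1]. *)
Definition in_base x :=
  2 * in_nodes x + 2 + in_size x * ((in_nodes x).+1 * (in_size x).+1).
Definition in_width x i := in_base x ^ ((in_nodes x).+1 - in_depth x i).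
Definition in_left x i :=
  \sum_(j < in_nodes x) in_anc x j i * ((2 * j + 1) * in_width x j).
(** Levels come in blocks of length [(in_size x).+1]. Cluster tops sit at multiples of it, and the
    height of an edge with [c] common ancestors lies strictly between the tops of the nodes of depth
    [c.+1] and of depth [c], since ranks run from 1 to [in_size x]. *)
Definition in_top x i := ((in_nodes x).+1 - in_depth x i) * (in_size x).+1.
Definition in_height x (uv : nat * nat) s :=
  (in_nodes x - in_common x uv.1 uv.2) * (in_size x).+1 + s.

Definition pos_point (a b : nat) : dom point_ty := (((a, 0), 0), ((b, 0), 0)).
Definition neg_point (a b : nat) : dom point_ty := (((a, 0), 0), ((0, b), 0)).

Definition out_vertex x i : dom point_ty := pos_point (in_left x i) 0.
(** The rank [s] is the horizontal advance of the oblique segments per unit of height, and also the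
    offset of the height. The corners are thus integral, and both quantities differ from edge to
    edge. *)
Definition out_edge x (uv : nat * nat) s : seq (dom point_ty) :=
  [:: pos_point (in_left x uv.1) 0;
      pos_point (in_left x uv.1 + s * in_height x uv s) (in_height x uv s);
      pos_point (in_left x uv.2 + s * in_height x uv s) (in_height x uv s);
      pos_point (in_left x uv.2) 0].
Definition out_region x i : seq (dom point_ty) :=
  [:: neg_point (in_left x i) (in_top x i);
      neg_point (in_left x i + in_width x i) (in_top x i);
      pos_point (in_left x i + in_width x i) (in_top x i);
      pos_point (in_left x i) (in_top x i)].
Definition algorithm x : dom output_ty :=
  (mkseq (out_vertex x) (in_verts x),
   (map_rank (out_edge x) (in_edges x),
    mkseq (fun mu => out_region x (in_verts x + mu)) (in_clus x))).

Lemma computable_in_verts a (x : dom a -> dom input_ty) : computable x ->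
  @computable a Nat (fun z => in_verts (x z)).
Proof.
move=> cx; apply: (@computable_fst a Nat Nat (fun z => (x z).1)).
exact: (@computable_fst a (Prod Nat Nat) (Prod (List (Prod Nat Nat)) (List Nat)) x).
Qed.

Lemma computable_in_clus a (x : dom a -> dom input_ty) : computable x ->
  @computable a Nat (fun z => in_clus (x z)).
Proof.
move=> cx; apply: (@computable_snd a Nat Nat (fun z => (x z).1)).
exact: (@computable_fst a (Prod Nat Nat) (Prod (List (Prod Nat Nat)) (List Nat)) x).
Qed.

Lemma computable_in_edges a (x : dom a -> dom input_ty) : computable x ->
  @computable a (List (Prod Nat Nat)) (fun z => in_edges (x z)).
Proof.
move=> cx; apply: (@computable_fst a (List (Prod Nat Nat)) (List Nat) (fun z => (x z).2)).
exact: (@computable_snd a (Prod Nat Nat) (Prod (List (Prod Nat Nat)) (List Nat)) x).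
Qed.

Lemma computable_in_parents a (x : dom a -> dom input_ty) : computable x ->
  @computable a (List Nat) (fun z => in_parents (x z)).
Proof.
move=> cx; apply: (@computable_snd a (List (Prod Nat Nat)) (List Nat) (fun z => (x z).2)).
exact: (@computable_snd a (Prod Nat Nat) (Prod (List (Prod Nat Nat)) (List Nat)) x).
Qed.

Lemma computable_in_nodes a (x : dom a -> dom input_ty) : computable x ->
  @computable a Nat (fun z => in_nodes (x z)).
Proof.
by move=> cx; apply: computable_add;
  [exact: computable_in_verts | exact: computable_in_clus].
Qed.

Lemma computable_in_size a (x : dom a -> dom input_ty) : computable x ->
  @computable a Nat (fun z => in_size (x z)).
Proof.
by move=> cx; apply: (@computable_size a (Prod Nat Nat)); exact: computable_in_edges.
Qed.

Lemma computable_in_up a (x : dom a -> dom input_ty) (t : dom a -> nat) :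
  computable x -> @computable a Nat t ->
  @computable a Nat (fun z => in_up (x z) (t z)).
Proof.
move=> cx ct.
have cp : @computable a Nat (fun z => nth 0 (in_parents (x z)) (t z).-1).
  by apply: computable_nth; [exact: computable_in_parents | exact: computable_pred].
apply: (@computable_if0 a Nat) => //; first exact: computable_const.
apply: (@computable_if0 a Nat) => //; first exact: computable_const.
by apply: computable_add => //; exact: computable_in_verts.
Qed.

Lemma computable_in_anc a (x : dom a -> dom input_ty) (j i : dom a -> nat) :
  computable x -> @computable a Nat j -> @computable a Nat i ->
  @computable a Nat (fun z => in_anc (x z) (j z) (i z)).
Proof.
move=> cx cj ci; apply: computable_pos.
apply: (@computable_sum a (fun z => in_nodes (x z))
  (fun z d => (iter d (in_up (x z)) (i z).+1 == (j z).+1 : nat))).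
  exact: computable_in_nodes.
apply: computable_eqn; last exact/computable_succ/computable_wk.
apply: (@computable_iter (Prod a Nat) Nat (fun t => t.2) (fun t y => in_up (x t.1) y)
  (fun t => (i t.1).+1)).
- exact: computable_last.
- exact/computable_succ/computable_wk.
- apply: (@computable_in_up (Prod (Prod a Nat) Nat) (fun t => x t.1.1) (fun t => t.2)).
    exact: (@computable_wk (Prod a Nat) Nat input_ty (fun t => x t.1)
      (@computable_wk a Nat input_ty x cx)).
  exact: computable_last.
Qed.

Lemma computable_in_depth a (x : dom a -> dom input_ty) (i : dom a -> nat) :
  computable x -> @computable a Nat i ->
  @computable a Nat (fun z => in_depth (x z) (i z)).
Proof.
move=> cx ci; apply: (@computable_sum a (fun z => in_nodes (x z))
  (fun z j => in_anc (x z) j (i z))); first exact: computable_in_nodes.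
apply: (@computable_in_anc (Prod a Nat) (fun t => x t.1) (fun t => t.2) (fun t => i t.1)).
- exact: computable_wk.
- exact: computable_last.
- exact: computable_wk.
Qed.

Lemma computable_in_common a (x : dom a -> dom input_ty) (i i' : dom a -> nat) :
  computable x -> @computable a Nat i -> @computable a Nat i' ->
  @computable a Nat (fun z => in_common (x z) (i z) (i' z)).
Proof.
move=> cx ci ci'; apply: (@computable_sum a (fun z => in_nodes (x z))
  (fun z j => in_anc (x z) j (i z) * in_anc (x z) j (i' z))).
  exact: computable_in_nodes.
apply: computable_mul.
- apply: (@computable_in_anc (Prod a Nat) (fun t => x t.1) (fun t => t.2) (fun t => i t.1)).
  + exact: computable_wk.
  + exact: computable_last.
  + exact: computable_wk.
- apply: (@computable_in_anc (Prod a Nat) (fun t => x t.1) (fun t => t.2) (fun t => i' t.1)).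
  + exact: computable_wk.
  + exact: computable_last.
  + exact: computable_wk.
Qed.

Lemma computable_in_base a (x : dom a -> dom input_ty) : computable x ->
  @computable a Nat (fun z => in_base (x z)).
Proof.
move=> cx; have cN := computable_in_nodes cx; have cm := computable_in_size cx.
apply: computable_add; first apply: computable_add.
- by apply: computable_mul => //; exact: computable_const.
- exact: computable_const.
- apply: computable_mul => //.
  by apply: computable_mul; exact: computable_succ.
Qed.

Lemma computable_in_width a (x : dom a -> dom input_ty) (i : dom a -> nat) :
  computable x -> @computable a Nat i ->
  @computable a Nat (fun z => in_width (x z) (i z)).
Proof.
move=> cx ci; apply: computable_exp; first exact: computable_in_base.
apply: computable_sub; last exact: computable_in_depth.
exact/computable_succ/computable_in_nodes.
Qed.

Lemma computable_in_left a (x : dom a -> dom input_ty) (i : dom a -> nat) :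
  computable x -> @computable a Nat i ->
  @computable a Nat (fun z => in_left (x z) (i z)).
Proof.
move=> cx ci; apply: (@computable_sum a (fun z => in_nodes (x z))
  (fun z j => in_anc (x z) j (i z) * ((2 * j + 1) * in_width (x z) j))).
  exact: computable_in_nodes.
have cx1 : @computable (Prod a Nat) input_ty (fun t => x t.1) by exact: computable_wk.
have cj := computable_last a Nat.
apply: computable_mul.
  apply: (@computable_in_anc (Prod a Nat) (fun t => x t.1) (fun t => t.2) (fun t => i t.1)) => //.
  exact: computable_wk.
apply: computable_mul; last exact: (@computable_in_width (Prod a Nat) (fun t => x t.1)).
apply: computable_add; last exact: computable_const.
by apply: computable_mul => //; exact: computable_const.
Qed.

Lemma computable_in_top a (x : dom a -> dom input_ty) (i : dom a -> nat) :
  computable x -> @computable a Nat i ->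
  @computable a Nat (fun z => in_top (x z) (i z)).
Proof.
move=> cx ci; apply: computable_mul; last exact/computable_succ/computable_in_size.
apply: computable_sub; last exact: computable_in_depth.
exact/computable_succ/computable_in_nodes.
Qed.

Lemma computable_in_height a (x : dom a -> dom input_ty)
    (uv : dom a -> dom (Prod Nat Nat)) (s : dom a -> nat) :
  computable x -> computable uv -> @computable a Nat s ->
  @computable a Nat (fun z => in_height (x z) (uv z) (s z)).
Proof.
move=> cx cuv cs; apply: computable_add => //.
apply: computable_mul; last exact/computable_succ/computable_in_size.
apply: computable_sub; first exact: computable_in_nodes.
apply: computable_in_common => //.
- exact: (@computable_fst a Nat Nat).
- exact: (@computable_snd a Nat Nat).
Qed.

Lemma computable_pos_point a (f g : dom a -> nat) :
  @computable a Nat f -> @computable a Nat g ->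
  @computable a point_ty (fun z => pos_point (f z) (g z)).
Proof.
move=> cf cg; have c0 := @computable_const a 0.
apply: (@computable_pair a rat_ty rat_ty); apply: (@computable_pair a (Prod Nat Nat) Nat) => //;
  exact: (@computable_pair a Nat Nat).
Qed.

Lemma computable_neg_point a (f g : dom a -> nat) :
  @computable a Nat f -> @computable a Nat g ->
  @computable a point_ty (fun z => neg_point (f z) (g z)).
Proof.
move=> cf cg; have c0 := @computable_const a 0.
apply: (@computable_pair a rat_ty rat_ty); apply: (@computable_pair a (Prod Nat Nat) Nat) => //;
  exact: (@computable_pair a Nat Nat).
Qed.

Lemma computable_out_vertex a (x : dom a -> dom input_ty) (i : dom a -> nat) :
  computable x -> @computable a Nat i ->
  @computable a point_ty (fun z => out_vertex (x z) (i z)).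
Proof.
move=> cx ci; apply: computable_pos_point; last exact: computable_const.
exact: computable_in_left.
Qed.

Lemma computable_out_edge a (x : dom a -> dom input_ty)
    (uv : dom a -> dom (Prod Nat Nat)) (s : dom a -> nat) :
  computable x -> computable uv -> @computable a Nat s ->
  @computable a (List point_ty) (fun z => out_edge (x z) (uv z) (s z)).
Proof.
move=> cx cuv cs; have ch := computable_in_height cx cuv cs.
have cu := @computable_fst a Nat Nat uv cuv.
have cv := @computable_snd a Nat Nat uv cuv.
have cl := computable_in_left cx cu; have cr := computable_in_left cx cv.
have c0 := @computable_const a 0.
have csh := computable_mul cs ch.
have clh := computable_add cl csh; have crh := computable_add cr csh.
apply: (@computable_cons a point_ty); first exact: computable_pos_point.
apply: (@computable_cons a point_ty); first exact: computable_pos_point.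
apply: (@computable_cons a point_ty); first exact: computable_pos_point.
apply: (@computable_cons a point_ty); first exact: computable_pos_point.
exact: computable_nil.
Qed.

Lemma computable_out_region a (x : dom a -> dom input_ty) (i : dom a -> nat) :
  computable x -> @computable a Nat i ->
  @computable a (List point_ty) (fun z => out_region (x z) (i z)).
Proof.
move=> cx ci; have ct := computable_in_top cx ci.
have cl := computable_in_left cx ci; have cw := computable_in_width cx ci.
have clw := computable_add cl cw.
apply: (@computable_cons a point_ty); first exact: computable_neg_point.
apply: (@computable_cons a point_ty); first exact: computable_neg_point.
apply: (@computable_cons a point_ty); first exact: computable_pos_point.
apply: (@computable_cons a point_ty); first exact: computable_pos_point.
exact: computable_nil.
Qed.

Lemma computable_algorithm : @computable input_ty output_ty algorithm.
Proof.
have cx := computable_id input_ty.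
have cx1 : @computable (Prod input_ty Nat) input_ty (fun t => t.1).
  exact: (@computable_wk input_ty Nat input_ty (fun x => x)).
apply: (@computable_pair _ (List point_ty) (Prod (List (List point_ty)) (List (List point_ty)))).
  apply: (@computable_mkseq _ point_ty in_verts out_vertex).
    exact: (computable_in_verts cx).
  exact: (computable_out_vertex cx1 (computable_last _ _)).
apply: (@computable_pair _ (List (List point_ty)) (List (List point_ty))).
  apply: (@computable_map_rank _ (Prod Nat Nat) (List point_ty) in_edges out_edge).
    exact: (computable_in_edges cx).
  apply: (@computable_out_edge (Prod (Prod input_ty (Prod Nat Nat)) Nat)
    (fun t => t.1.1) (fun t => t.1.2) (fun t => t.2)).
  - exact: (@computable_wk (Prod input_ty (Prod Nat Nat)) Nat input_ty (fun t => t.1)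
      (@computable_wk input_ty (Prod Nat Nat) input_ty (fun x => x) cx)).
  - exact: (@computable_wk (Prod input_ty (Prod Nat Nat)) Nat (Prod Nat Nat)
      (fun t => t.2) (computable_last _ _)).
  - exact: computable_last.
apply: (@computable_mkseq _ (List point_ty) in_clus
  (fun x mu => out_region x (in_verts x + mu))).
  exact: (computable_in_clus cx).
apply: (computable_out_region cx1); apply: computable_add.
  exact: (computable_in_verts cx1).
exact: computable_last.
Qed.

End Algorithm.

(** * The arithmetic of the algorithm computes ancestors, intervals and heights of the tree *)

Section CodedTree.
Local Open Scope nat_scope.
Variable C : cgraph.
Notation n := (nvert C).
Notation k := (nclus C).
Notation node := ('I_(nvert C) + 'I_(nclus C))%type.
Notation prel := (parent_rel (@par C)).
Notation inp := (code_cgraph C).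
Notation m := #|cedge C|.

Definition node_code (y : node) : nat :=
  match y with inl v => nat_of_ord v | inr mu => n + mu end.

Lemma node_code_inj : injective node_code.
Proof.
move=> [v|mu] [w|nu] /= h.
- by congr inl; apply: val_inj.
- by have := ltn_ord v; rewrite h ltnNge leq_addr.
- by have := ltn_ord w; rewrite -h ltnNge leq_addr.
- by congr inr; apply: val_inj; apply: (addnI h).
Qed.

Lemma card_node : #|{: node}| = in_nodes inp.
Proof. by rewrite card_sum !card_ord. Qed.

Lemma node_code_lt y : node_code y < #|{: node}|.
Proof.
rewrite card_node; case: y => [v|mu] /=; last by rewrite ltn_add2l.
by rewrite (leq_trans (ltn_ord v)) ?leq_addr.
Qed.

Lemma in_size_code : in_size inp = m.
Proof. by rewrite /in_size size_map -cardE. Qed.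

Lemma nth_in_parents y : nth 0 (in_parents inp) (node_code y) = code_parent (par y).
Proof.
rewrite /in_parents /= nth_cat size_map size_enum_ord; case: y => [v|mu] /=.
  rewrite ltn_ord (nth_map v) ?size_enum_ord// nth_ord_enum //.
rewrite ltnNge leq_addr /= addKn (nth_map mu) ?size_enum_ord// nth_ord_enum //.
Qed.

Definition up_node (o : option node) : option node :=
  if o is Some y then omap inr (par y) else None.

Definition onode_code (o : option node) : nat :=
  if o is Some y then (node_code y).+1 else 0.

Lemma in_upE o : in_up inp (onode_code o) = onode_code (up_node o).
Proof.
case: o => [y|] //; rewrite /in_up /= nth_in_parents.
by case: (par y) => //= mu; rewrite addnS.
Qed.

Lemma iter_in_up d o : iter d (in_up inp) (onode_code o) = onode_code (iter d up_node o).
Proof. by elim: d => //= d ->; exact: in_upE. Qed.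

Lemma parent_relE y z : prel y z = (up_node (Some y) == Some z).
Proof. by rewrite /parent_rel /=; case: (par y). Qed.

Lemma iter_up_path y p : path prel y p -> iter (size p) up_node (Some y) = Some (last y p).
Proof.
elim: p y => //= z p IH y /andP[]; rewrite parent_relE => /eqP yz /IH <-.
by rewrite -yz -iterSr.
Qed.

Lemma in_ancE y z : in_anc inp (node_code y) (node_code z) = connect prel z y.
Proof.
rewrite /in_anc; congr nat_of_bool.
have itE d : (iter d (in_up inp) (node_code z).+1 == (node_code y).+1)
    = (iter d up_node (Some z) == Some y).
  rewrite -[(node_code z).+1]/(onode_code (Some z)) iter_in_up.
  by case: (iter d up_node (Some z)) => //= w; rewrite eqSS (inj_eq node_code_inj).
apply/idP/idP.
  rewrite lt0n sum_nat_eq0 negb_forall => /existsP[[d /= _]].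
  rewrite itE eqb0 negbK => {itE}; elim: d y => [|d IH] y /=.
    by move=> /eqP[->]; exact: connect0.
  case E: (iter d up_node (Some z)) => [w|//] wy.
  by apply: connect_trans (IH w _) (connect1 _); rewrite ?E// parent_relE.
(* A path without repetition has fewer steps than there are nodes, so its length is an index of the
   bounded sum. *)
move=> /connectP[p zp ->]; case: (shortenP zp) => p' zp' up' _ {p zp}.
have lt : size p' < in_nodes inp.
  by have := max_card [in z :: p']; rewrite (card_uniqP up') card_node.
rewrite (bigD1 (Ordinal lt)) //= ltn_addr//.
rewrite -[(node_code z).+1]/(onode_code (Some z)) iter_in_up iter_up_path//.
by rewrite /= eqxx.
Qed.

Lemma sum_nodes (F : nat -> nat) :
  \sum_(j < in_nodes inp) F j = \sum_(y : node) F (node_code y).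
Proof. by rewrite big_split_ord big_sumType. Qed.

Lemma in_depthE y : in_depth inp (node_code y) = depth prel y.
Proof.
rewrite /in_depth (sum_nodes (fun j => in_anc inp j (node_code y))) /depth.
rewrite -sum1dep_card [RHS]big_mkcond /=.
by apply: eq_bigr => z _; rewrite in_ancE; case: connect.
Qed.

Lemma in_commonE y z : in_common inp (node_code y) (node_code z) =
  #|[set w | connect prel y w && connect prel z w]|.
Proof.
rewrite /in_common.
rewrite (sum_nodes (fun j => in_anc inp j (node_code y) * in_anc inp j (node_code z))).
rewrite -sum1dep_card [RHS]big_mkcond /=.
by apply: eq_bigr => w _; rewrite !in_ancE; do 2 case: connect.
Qed.

Notation lft := (ileft prel node_code (in_base inp) (in_nodes inp).+1).
Notation wid := (iwidth prel (in_base inp) (in_nodes inp).+1).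

Lemma in_widthE y : in_width inp (node_code y) = wid y.
Proof. by rewrite /in_width in_depthE. Qed.

Lemma in_leftE y : in_left inp (node_code y) = lft y.
Proof.
rewrite /in_left (sum_nodes (fun j =>
  in_anc inp j (node_code y) * ((2 * j + 1) * in_width inp j))).
rewrite /ileft [RHS]big_mkcond /=.
apply: eq_bigr => z _; rewrite in_ancE in_widthE.
by case: connect; rewrite ?mul1n.
Qed.

Lemma prel_root : exists r, [/\ forall x y z, prel x y -> prel x z -> y = z,
  forall y, ~~ prel r y & forall x, connect prel x r].
Proof.
have [[r rN rC] _] := par_tree C; exists r; split=> //.
  by move=> x y z; rewrite /parent_rel /=; case: (par x) => // mu /eqP -> /eqP.
by move=> y; rewrite /parent_rel /= rN.
Qed.

Let base_large : 2 * #|{: node}| + 2 <= in_base inp.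
Proof. by rewrite card_node leq_addr. Qed.

Let exponent_large : #|{: node}| < (in_nodes inp).+1.
Proof. by rewrite card_node. Qed.

Lemma in_nested y z : connect prel y z -> y != z ->
  in_left inp (node_code z) < in_left inp (node_code y) /\
  in_left inp (node_code y) + in_width inp (node_code y) <
  in_left inp (node_code z) + in_width inp (node_code z).
Proof.
rewrite !in_leftE !in_widthE; have [r [h1 h2 h3]] := prel_root.
exact: (nested h1 h2 h3 node_code_lt base_large exponent_large).
Qed.

Lemma in_separated y z : ~~ connect prel y z -> ~~ connect prel z y ->
  (in_left inp (node_code y) + in_width inp (node_code y) < in_left inp (node_code z)) ||
  (in_left inp (node_code z) + in_width inp (node_code z) < in_left inp (node_code y)).
Proof.
rewrite !in_leftE !in_widthE; have [r [h1 h2 h3]] := prel_root.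
exact: (separated_intervals h1 h2 h3 node_code_inj node_code_lt base_large exponent_large).
Qed.

Lemma in_width_gt0 y : 0 < in_width inp (node_code y).
Proof. by rewrite in_widthE; exact: iwidth_gt0. Qed.

Lemma in_depth_le y : in_depth inp (node_code y) <= in_nodes inp.
Proof. by rewrite in_depthE -card_node depth_le. Qed.

Lemma in_top_gt0 y : 0 < in_top inp (node_code y).
Proof. by have := in_depth_le y; rewrite muln_gt0 /= subn_gt0 ltnS => ->. Qed.

Lemma in_top_lt y z : connect prel y z -> y != z ->
  in_top inp (node_code y) < in_top inp (node_code z).
Proof.
move=> yz ne; have [r [h1 h2 h3]] := prel_root.
have := depth_lt h1 h2 h3 yz ne; rewrite -!in_depthE => lt.
by rewrite ltn_pmul2r//; have := in_depth_le y; lia.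
Qed.

Lemma in_common_le y z : in_common inp (node_code y) (node_code z) <= in_nodes inp.
Proof. by rewrite in_commonE -card_node max_card. Qed.

(** All ancestors of [z] are common to [u] and [v], so the depth of [z] is at most their number, and
    [s <= m] keeps the offset within the block. *)
Lemma in_height_lt_top (u v : 'I_n) s z : s <= m ->
  connect prel (inl u) z -> connect prel (inl v) z ->
  in_height inp (nat_of_ord u, nat_of_ord v) s < in_top inp (node_code z).
Proof.
move=> sm uz vz; rewrite /in_height /in_top in_size_code /=.
have dc : in_depth inp (node_code z) <= in_common inp u v.
  rewrite in_depthE (in_commonE (inl u) (inl v)); apply: subset_leq_card.
  by apply/subsetP => w; rewrite !inE => zw; rewrite !(connect_trans _ zw).
have := in_common_le (inl u) (inl v); rewrite /= => cN.
set q := in_nodes inp - _; have : q.+1 <= (in_nodes inp).+1 - in_depth inp (node_code z) by lia.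
rewrite -(leq_pmul2r (ltn0Sn m)); apply: leq_trans.
by rewrite mulSn addnC ltn_add2r ltnS.
Qed.

(** Let [l] be the lowest common ancestor of [u] and [v]. Either [z] is deeper than [l], hence lower
    than the edge, or [z] and [l] are incomparable; then the interval of [l], with both strips
    inside, lies on one side of that of [z]. *)
Lemma in_top_lt_height (u v : 'I_n) s z : 0 < s ->
  ~~ (connect prel (inl u) z && connect prel (inl v) z) ->
  [\/ in_top inp (node_code z) < in_height inp (nat_of_ord u, nat_of_ord v) s,
      in_left inp (node_code z) + in_width inp (node_code z) < in_left inp u /\
      in_left inp (node_code z) + in_width inp (node_code z) < in_left inp v |
      in_left inp u + in_width inp u < in_left inp (node_code z) /\
      in_left inp v + in_width inp v < in_left inp (node_code z)].
Proof.
move=> s0 nz; have [r [h1 h2 h3]] := prel_root.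
have [l [ul vl dl out]] := lowest_common h1 h2 h3 (inl u) (inl v).
have wk (w : 'I_n) : connect prel (inl w) l ->
    in_left inp (node_code l) <= in_left inp w /\
    in_left inp w + in_width inp w <=
    in_left inp (node_code l) + in_width inp (node_code l).
  move=> wl; have [<- //|ne] := eqVneq (inl w) l.
  by have [? ?] := in_nested wl ne; split; exact: ltnW.
have [u1 u2] := wk u ul; have [v1 v2] := wk v vl.
case: (out z nz) => [lt|[nzl nlz]].
  constructor 1; rewrite /in_height /in_top in_size_code /=.
  have c : in_common inp u v = in_depth inp (node_code l).
    by rewrite (in_commonE (inl u) (inl v)) in_depthE dl.
  rewrite -!in_depthE in lt; rewrite c.
  apply: (@leq_ltn_trans ((in_nodes inp - in_depth inp (node_code l)) * m.+1)).
    by rewrite leq_mul2r /=; lia.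
  by rewrite -[ltnLHS]addn0 ltn_add2l.
by case/orP: (in_separated nzl nlz) => lt; [constructor 2 | constructor 3]; split; lia.
Qed.

(** This is what the product in [in_base] is made for: it is a lower bound of every width. *)
Lemma slope_height_le (u v : 'I_n) s y : s <= m ->
  s * in_height inp (nat_of_ord u, nat_of_ord v) s <= in_width inp (node_code y).
Proof.
move=> sm; rewrite in_widthE; apply: leq_trans (iwidth_ge _ base_large exponent_large y).
rewrite /in_base in_size_code /in_height in_size_code /=.
apply: leq_trans (leq_addl _ _); apply: leq_mul => //.
rewrite mulSn addnC leq_add ?(leq_trans sm)// leq_mul2r.
by apply/orP; right; exact: leq_subr.
Qed.

Lemma in_height_inj uv uv' s s' : s <= m -> s' <= m ->
  in_height inp uv s = in_height inp uv' s' -> s = s'.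
Proof.
move=> sm sm'; rewrite /in_height in_size_code => /(congr1 (modn^~ m.+1)).
by rewrite !modnMDl !modn_small.
Qed.

End CodedTree.

Lemma map_rank_map (A : eqType) (A' B : Type) (F : A' -> nat -> B) (g : A -> A') s :
  uniq s -> map_rank F (map g s) =
    [seq F (g y) (size s - index y s)%N | y <- s].
Proof.
elim: s => //= y s IH /andP[ys us]; rewrite eqxx subn0.
rewrite /map_rank /= size_map; congr cons; rewrite -/(map_rank F (map g s)) IH//.
apply/eq_in_map => z zs.
by case: eqVneq => [e|_]; [rewrite e zs in ys | rewrite subSS].
Qed.

From mathcomp Require Import all_classical all_reals all_analysis.

Import Order.TTheory GRing.Theory Num.Theory.
Import numFieldNormedType.Exports.

Local Open Scope card_scope.
Local Open Scope classical_set_scope.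
Local Open Scope ring_scope.

(** * Planar graphs are sparse *)

Section ArcSampling.
Variable R : realType.
Notation plane := (R * R)%type.
Implicit Types g : R -> plane.

(** Uniform continuity by compactness of the segment. *)
Lemma arc_unif_continuous g (e : R) : {within `[0, 1], continuous g} -> 0 < e ->
  \forall d \near 0^'+, forall x y, x \in `[0, 1] -> y \in `[0, 1] ->
    `|x - y| < d -> `|g x - g y| < e.
Proof.
move=> /subspace_continuousP cg e0.
have := proj1 (@compact_near_coveringP _ _) (@segment_compact R 0 1).
move=> /(_ R (0^'+) (fun d x => forall y, y \in `[0, 1] ->
    `|x - y| < d -> x \in `[0, 1] -> `|g x - g y| < e) _) [].
- move=> x x01.
  have e2 : 0 < e / 2 by rewrite divr_gt0.
  have /cvgrPdist_lt /(_ _ e2) := cg x x01.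
  rewrite near_withinE => /nbhs_ballP[r /= r0 H].
  exists (ball x (r / 2), [set d | d < r / 2]); first split=> /=.
  + by apply: nbhsx_ballx; rewrite divr_gt0.
  + by apply: nbhs_right_lt; rewrite divr_gt0.
  + move=> [x' d] /= [xx' dr] y y01 x'y x'01.
    have b1 : ball x r x'.
      by apply: le_ball xx'; rewrite ler_pdivrMr// ler_peMr ?ltW// ltr1n.
    have b2 : ball x r y.
      rewrite -(subrK x' x) [X in ball X]addrC /ball /=.
      rewrite (_ : x' + (x - x') - y = (x - x') + (x' - y)); last by ring.
      rewrite (le_lt_trans (ler_normD _ _))// [r]splitr ltrD//.
      exact: lt_trans x'y dr.
    have h1 := H _ b1 x'01; have h2 := H _ b2 y01.
    rewrite (_ : g x' - g y = - (g x - g x') + (g x - g y)); last first.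
      by rewrite opprB addrA subrK.
    by rewrite (le_lt_trans (ler_normD _ _))// normrN [e]splitr ltrD.
- move=> d d0 H; exists d => // z zd z0 x y x01 y01 xy.
  exact: (H _ zd z0 x x01 y y01 xy x01).
Qed.

(** Disjoint compact sets have positive distance. The form with a filter lets one [d] serve for the
    finitely many pairs of edges at once. *)
Lemma arcs_apart g g' : {within `[0, 1], continuous g} ->
  {within `[0, 1], continuous g'} -> closed_arc g `&` closed_arc g' = set0 ->
  \forall d \near 0^'+, forall x y, x \in `[0, 1] -> y \in `[0, 1] ->
    d <= `|g x - g' y|.
Proof.
move=> cg cg' dis.
have cpt := continuous_compact cg (@segment_compact R 0 1).
have cpt' := continuous_compact cg' (@segment_compact R 0 1).
have cl : closed (closed_arc g').
  apply: compact_closed cpt'.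
  exact: norm_hausdorff.
have := proj1 (@compact_near_coveringP _ _) cpt.
move=> /(_ R (0^'+) (fun d x => forall y, y \in `[0, 1] -> d <= `|x - g' y|) _) [].
- move=> x gx.
  have nx : ~ closed_arc g' x.
    move=> g'x.
    by have : (closed_arc g `&` closed_arc g') x by []; rewrite dis.
  have /nbhs_ballP[r /= r0 H] : nbhs x (~` closed_arc g').
    by apply: open_nbhs_nbhs; split=> //; apply: closed_openC.
  exists (ball x (r / 2), [set d | d < r / 2]); first split=> /=.
  + by apply: nbhsx_ballx; rewrite divr_gt0.
  + by apply: nbhs_right_lt; rewrite divr_gt0.
  + move=> [x' d] /= [xx' dr] y y01.
    rewrite leNgt; apply/negP => lt.
    apply: (H (g' y)); last by exists y.
    rewrite -ball_normE /=.
    rewrite (_ : x - g' y = (x - x') + (x' - g' y)); last first.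
      by rewrite addrA subrK.
    rewrite (le_lt_trans (ler_normD _ _))// [r]splitr ltrD//.
      by move: xx'; rewrite -ball_normE.
    exact: lt_trans lt dr.
- move=> d d0 H; exists d => // z zd z0 x y x01 y01.
  by apply: (H _ zd z0 (g x)) => //; exists x.
Qed.

Definition sample g (N i : nat) : plane := g (i%:R / N%:R).

Lemma sample_step g (e : R) : {within `[0, 1], continuous g} -> 0 < e ->
  \forall N \near \oo, forall i, (i < N)%N ->
    `|sample g N i - sample g N i.+1| < e.
Proof.
move=> cg e0.
have [d d0 /=  H] := arc_unif_continuous cg e0.
have d20 : 0 < d / 2 by rewrite divr_gt0.
have := near_infty_natSinv_lt (PosNum d20).
case=> M _ HM.
exists M.+1 => //= N /= MN i iN.
have N0 : 0 < N%:R :> R by rewrite ltr0n; lia.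
have in01 (j : nat) : (j <= N)%N -> (j%:R / N%:R : R) \in `[0, 1].
  move=> jN; rewrite in_itv /= divr_ge0//= ler_pdivrMr// mul1r ler_nat//.
apply: (H (d / 2)).
- by rewrite /= sub0r normrN gtr0_norm// ltr_pdivrMr// ltr_pMr// ltr1n.
- by [].
- exact: in01 (ltnW iN).
- exact: in01 iN.
- rewrite -mulrBl -natr1 opprD addrA subrr add0r mulN1r normrN.
  have := HM N.-1; rewrite prednK; last lia.
  move=> HN.
  rewrite ger0_norm ?invr_ge0 ?ltW//.
  apply: HN => /=; lia.
Qed.

End ArcSampling.

(** * Parities of ray crossings and the relation between two disjoint arcs *)

Section Winding.
Variable R : realType.
Notation plane := (R * R)%type.
Implicit Types d : plane.

(** The lexicographic order, second coordinate first: an upper half plane with one half of its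
    boundary line, so that it contains exactly one of [d] and [- d] when [d != 0]. Samples on the
    axis thereby get a definite side. *)
Definition lexpos d : bool := (0 < d.2) || ((d.2 == 0) && (0 < d.1)).

Lemma lexposN d : d != 0 -> lexpos (- d) = ~~ lexpos d.
Proof.
case: d => x y; rewrite xpair_eqE /lexpos /= oppr_eq0 !oppr_gt0.
by case: (ltgtP y 0) => //= _; case: (ltgtP x 0).
Qed.

(* For a short step away from the origin: does it cross the positive x-axis? *)
Definition ray d d' : bool := (lexpos d (+) lexpos d') && (0 < d.1).

(** A change of side by a step shorter than [e] forces both second coordinates below [e] in absolute
    value. The norm is the maximum of the coordinates, so both first coordinates are at least [e] in
    absolute value, and they cannot have opposite signs. *)
Lemma lexpos_change (e : R) d d' : e <= `|d| -> e <= `|d'| -> `|d - d'| < e ->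
  lexpos d (+) lexpos d' -> (0 < d.1) = (0 < d'.1) /\ d.1 != 0.
Proof.
case: d d' => [x y] [x' y']; rewrite !prod_normE /= gt_max !le_max.
rewrite /lexpos /= => + + /andP[]; rewrite !ltr_norml !ler_normr.
move=> hd hd' hx hy.
case: (ltgtP y 0) => hy0; case: (ltgtP y' 0) => hy0' //=;
  case: (ltgtP x 0) => hx0; case: (ltgtP x' 0) => hx0' //=; exfalso; lra.
Qed.

(** After the point reflection the crossings of the negative half axis are counted; together with
    those of the positive one they are all the changes of side. *)
Lemma rayN (e : R) d d' : 0 < e -> e <= `|d| -> e <= `|d'| -> `|d - d'| < e ->
  ray (- d) (- d') = ray d d' (+) (lexpos d (+) lexpos d').
Proof.
move=> e0 h1 h2 h3; have := lexpos_change h1 h2 h3.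
have nz (k : plane) : e <= `|k| -> k != 0.
  by move=> ek; rewrite -normr_gt0 (lt_le_trans e0).
rewrite /ray !lexposN ?nz//.
rewrite addNb addbN negbK (_ : (- d).1 = - d.1)// oppr_gt0.
by case: (_ (+) _) => // /(_ isT) [_]; case: ltgtP.
Qed.

(** A cell too small to surround the origin has winding parity zero. All changes of side among its
    four corners happen on the same half axis, and around a closed walk their number is even. *)
Lemma ray_quad (e : R) d1 d2 d3 d4 :
  e <= `|d1| -> e <= `|d2| -> e <= `|d3| -> e <= `|d4| ->
  `|d1 - d2| < e -> `|d1 - d3| < e -> `|d1 - d4| < e ->
  `|d2 - d3| < e -> `|d2 - d4| < e -> `|d3 - d4| < e ->
  ray d1 d2 (+) ray d3 d4 = ray d1 d3 (+) ray d2 d4.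
Proof.
move=> n1 n2 n3 n4 h12 h13 h14 h23 h24 h34.
have change d d' : e <= `|d| -> e <= `|d'| -> `|d - d'| < e ->
    (lexpos d (+) lexpos d') ==> ((0 < d.1) == (0 < d'.1)).
  by move=> n n' h; apply/implyP => /(lexpos_change n n' h)[-> _].
move: (change _ _ n1 n2 h12) (change _ _ n1 n3 h13) (change _ _ n1 n4 h14)
  (change _ _ n2 n3 h23) (change _ _ n2 n4 h24) (change _ _ n3 n4 h34).
rewrite /ray; move: (lexpos d1) (lexpos d2) (lexpos d3) (lexpos d4).
move: (0 < d1.1) (0 < d2.1) (0 < d3.1) (0 < d4.1).
by do 8 case.
Qed.

(** A discrete Green formula modulo 2: each inner side belongs to two cells, so only the boundary of
    the grid survives. *)
Lemma grid_sum (h v : nat -> nat -> bool) N M :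
  (forall i j, (i < N)%N -> (j < M)%N ->
     h i j (+) h i j.+1 = v i j (+) v i.+1 j) ->
  (\big[addb/false]_(i < N) h i 0%N) (+) (\big[addb/false]_(i < N) h i M) =
  (\big[addb/false]_(j < M) v 0%N j) (+) (\big[addb/false]_(j < M) v N j).
Proof.
elim: N => [|N IH] H; first by rewrite !big_ord0 !addbb.
rewrite !big_ord_recr /= addbACA IH; last by move=> i j iN jM; apply: H => //; lia.
have : forall m, (m <= M)%N -> h N 0%N (+) h N m =
    (\big[addb/false]_(j < m) v N j) (+) (\big[addb/false]_(j < m) v N.+1 j).
  elim=> [|m IHm] mM; first by rewrite !big_ord0 !addbb.
  rewrite !big_ord_recr /= addbACA -IHm; last exact: ltnW.
  by rewrite -H//; case: (h N 0%N); case: (h N m); case: (h N m.+1).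
move=> /(_ M (leqnn _)) ->.
by rewrite addbA -[X in X (+) _]addbA addbb addbF.
Qed.

Lemma telescope_addb (f : nat -> bool) N :
  \big[addb/false]_(i < N) (f i (+) f i.+1) = f 0%N (+) f N.
Proof.
elim: N => [|N IH]; first by rewrite big_ord0 addbb.
by rewrite big_ord_recr /= IH addbA -[X in X (+) _]addbA addbb addbF.
Qed.

Definition winding (v : plane) (g : R -> plane) (N : nat) : bool :=
  \big[addb/false]_(i < N) ray (sample g N i - v) (sample g N i.+1 - v).

(* [2 * e] so that the diagonals of the grid cells stay shorter than the
   distance to the origin *)
Lemma winding_relation (e : R) (g g' : R -> plane) N : (0 < N)%N -> 0 < e ->
  (forall i, (i < N)%N -> `|sample g N i - sample g N i.+1| < e) ->
  (forall i, (i < N)%N -> `|sample g' N i - sample g' N i.+1| < e) ->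
  (forall i j, (i <= N)%N -> (j <= N)%N ->
     2 * e <= `|sample g N i - sample g' N j|) ->
  winding (g' 0) g N (+) winding (g' 1) g N =
  (winding (g 0) g' N (+) winding (g 1) g' N) (+)
  ((lexpos (g' 0 - g 0) (+) lexpos (g' 1 - g 0)) (+)
   (lexpos (g' 0 - g 1) (+) lexpos (g' 1 - g 1))).
Proof.
move=> N0 e0 sg sg' far.
have s0 k : sample k N 0 = k 0 by rewrite /sample mul0r.
have s1 k : sample k N N = k 1 by rewrite /sample divff// pnatr_eq0; lia.
(* In this grid of differences a side of fixed [j] measures the winding of [g] around a sample of
   [g'], and a side of fixed [i] that of [g'] around a sample of [g], up to sign. *)
pose F i j := sample g N i - sample g' N j.
have e2 : e < 2 * e by rewrite ltr_pMl// ltr1n.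
have Fi i j : (i < N)%N -> `|F i j - F i.+1 j| < e.
  by move=> iN; rewrite /F opprB addrA subrK; exact: sg.
have Fj i j : (j < N)%N -> `|F i j - F i j.+1| < e.
  move=> jN; rewrite /F opprB addrC addrA subrK -normrN opprB; exact: sg'.
(* Correcting the sign costs the changes of side, which telescope along [j] into the order terms of
   the conclusion. *)
have nFj i j : (i <= N)%N -> (j < N)%N ->
    ray (F i j) (F i j.+1) = ray (sample g' N j - sample g N i)
       (sample g' N j.+1 - sample g N i) (+)
    (lexpos (sample g' N j - sample g N i) (+)
      lexpos (sample g' N j.+1 - sample g N i)).
  move=> iN jN.
  rewrite /F -[sample g N i - _]opprB -[sample g N i - sample g' N j.+1]opprB.
  apply: (rayN (e := 2 * e)); rewrite ?mulr_gt0//.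
  - by rewrite -normrN opprB far// ltnW.
  - by rewrite -normrN opprB far.
  - rewrite opprB addrA subrK (lt_trans _ e2)//; exact: sg'.
have two i j k l : `|F i j - F k l| < e -> `|F i j - F k l| < 2 * e.
  by move=> h; exact: lt_trans e2.
have dbl (x y z : plane) : `|x - y| < e -> `|y - z| < e -> `|x - z| < 2 * e.
  move=> xy yz; rewrite -(subrK y x) -addrA (le_lt_trans (ler_normD _ _))//.
  by rewrite mulr_natl mulr2n ltrD.
have sumF i : (i <= N)%N -> \big[addb/false]_(j < N) ray (F i j) (F i j.+1) =
   winding (sample g N i) g' N (+)
   (lexpos (g' 0 - sample g N i) (+) lexpos (g' 1 - sample g N i)).
  move=> iN; under eq_bigr => j _ do rewrite nFj//.
  rewrite big_split /=; congr (_ (+) _).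
  by rewrite (telescope_addb (fun j => lexpos (sample g' N j - _))) s0 s1.
have sumG j : \big[addb/false]_(i < N) ray (F i j) (F i.+1 j) =
   winding (sample g' N j) g N by [].
have := @grid_sum (fun i j => ray (F i j) (F i.+1 j))
  (fun i j => ray (F i j) (F i j.+1)) N N.
rewrite !sumG !sumF// !s0 !s1 addbACA; apply=> i j iN jN.
apply: (ray_quad (e := 2 * e)); rewrite ?far//; try exact: ltnW.
- exact/two/Fi.
- exact/two/Fj.
- by apply: (dbl _ (F i.+1 j)); [exact: Fi | exact: Fj].
- apply: (dbl _ (F i j)); last exact: Fj.
  rewrite -normrN opprB; exact: Fi.
- exact/two/Fj.
- exact/two/Fi.
Qed.

End Winding.

(** * A planar graph on [n] vertices has at most [4 n] edges *)

Section PlanarSparse.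
Variables (R : realType) (C : cgraph).

Lemma card_cedge_arcs : (2 * #|cedge C| = arcs_in (@adj C) [set: 'I_(nvert C)]%SET)%N.
Proof.
rewrite /arcs_in pair_big /= (eq_bigl predT); last first.
  by move=> p; rewrite !finset.in_setT.
rewrite (bigID (fun p : 'I_(nvert C) * 'I_(nvert C) => (p.1 < p.2)%N)) /=.
rewrite card_sig -sum1_card mul2n -addnn; congr (_ + _)%N.
  rewrite [LHS]big_mkcond [RHS]big_mkcond /=; apply: eq_bigr => p _.
  by rewrite inE; case: (_ < _)%N => //=; case: adj.
rewrite (reindex_inj (h := fun p : 'I_(nvert C) * 'I_(nvert C) => (p.2, p.1))) /=; last first.
  by move=> [a b] [c d] [-> ->].
rewrite [RHS](bigID (fun p : 'I_(nvert C) * 'I_(nvert C) => p.1 == p.2)) /=.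
rewrite [X in _ = (X + _)%N]big1 ?add0n; last first.
  by move=> [a b] /= /andP[_ /eqP ab]; rewrite ab adj_irr.
rewrite [LHS]big_mkcond [RHS]big_mkcond /=; apply: eq_bigr => -[a b] _ /=.
rewrite inE /= adj_sym -leqNgt -(inj_eq val_inj) /=.
by case: ltngtP => //=; case: adj.
Qed.

(** A common point would lie inside both arcs, or be a vertex inside an arc, or be a common end
    point. *)
Lemma graph_drawing_disjoint pt (ed : cedge C -> R -> R * R) e f :
  graph_drawing pt ed ->
  (forall e f, e != f -> open_arc (ed e) `&` open_arc (ed f) = set0) ->
  (val e).1 != (val f).1 -> (val e).1 != (val f).2 ->
  (val e).2 != (val f).1 -> (val e).2 != (val f).2 ->
  closed_arc (ed e) `&` closed_arc (ed f) = set0.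
Proof.
move=> [inj arc off] cross n11 n12 n21 n22; apply/seteqP; split=> // q [].
have ends k : closed_arc (ed k) q ->
    open_arc (ed k) q \/ q = pt (val k).1 \/ q = pt (val k).2.
  have [_ _ g0 g1] := arc k; move=> [t /= ]; rewrite in_itv /= => /andP[t0 t1] tq.
  move: t0 t1; rewrite le_eqVlt => /predU1P[t0 _|t0].
    by right; left; rewrite -tq -t0.
  rewrite le_eqVlt => /predU1P[t1|t1]; first by right; right; rewrite -tq t1.
  by left; exists t => //=; rewrite in_itv /= t0.
have ef : e != f by apply: contraNneq n11 => ->.
move=> /ends[eq|[]eq] /ends[fq|[]fq].
- by have : (open_arc (ed e) `&` open_arc (ed f)) q by []; rewrite cross.
- by move: eq; rewrite fq => /off.
- by move: eq; rewrite fq => /off.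
- by move: fq; rewrite eq => /off.
- by move: n11; rewrite (inj _ _ (etrans (esym eq) fq)) eqxx.
- by move: n12; rewrite (inj _ _ (etrans (esym eq) fq)) eqxx.
- by move: fq; rewrite eq => /off.
- by move: n21; rewrite (inj _ _ (etrans (esym eq) fq)) eqxx.
- by move: n22; rewrite (inj _ _ (etrans (esym eq) fq)) eqxx.
Qed.

Lemma planar_sparse : planar R C -> (#|cedge C| <= 4 * nvert C)%N.
Proof.
move=> [pt [ed [gd cross]]]; have [inj arc off] := gd.
rewrite leqNgt; apply/negP => dense.
have ced e : {within `[0, 1], continuous (ed e)} by have [] := arc e.
pose indep (p : cedge C * cedge C) :=
  [&& (val p.1).1 != (val p.2).1, (val p.1).1 != (val p.2).2,
      (val p.1).2 != (val p.2).1 & (val p.1).2 != (val p.2).2].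
have : \forall d \near 0^'+, forall p, indep p -> forall x y : R,
    x \in `[0, 1] -> y \in `[0, 1] -> d <= `|ed p.1 x - ed p.2 y|.
  apply: filter_forall => p; have [ip|nip] := boolP (indep p); last first.
    by apply: nearW.
  case/and4P: (ip) => n11 n12 n21 n22.
  have := arcs_apart (ced p.1) (ced p.2)
    (graph_drawing_disjoint gd cross n11 n12 n21 n22).
  by apply: filterS => d H _; exact: H.
case=> d d0 H.
have dd : ball_ [eta Num.Def.normr] 0 d (d / 2).
  by rewrite /= sub0r normrN gtr0_norm ?divr_gt0// ltr_pdivrMr// ltr_pMr// ltr1n.
have far := H _ dd (divr_gt0 d0 (ltr0n R 2)).
(* Independent edges are at distance at least [d / 2], and [winding_relation] wants twice the
   sampling step below that distance. *)
have e0 : 0 < d / 2 / 2 by rewrite !divr_gt0.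
have : \forall N \near \oo, forall e i, (i < N)%N ->
    `|sample (ed e) N i - sample (ed e) N i.+1| < d / 2 / 2.
  by apply: filter_forall => e; exact: sample_step.
case=> M _ /(_ M.+1) HM; have {}HM := HM (leqnSn M).
pose N := M.+1; pose u x y := lexpos (pt x - pt y).
(* Only the orientation with increasing end points exists as an edge; both orders of [a] and [b] are
   sent to it, so [w] is symmetric in them by construction. *)
pose edge (a b : 'I_(nvert C)) : option (cedge C) := insub (if (a < b)%N then (a, b) else (b, a)).
pose w v a b := if edge a b is Some e then winding (pt v) (ed e) N else false.
have edgeP a b : adj a b -> exists2 e, edge a b = Some e &
    val e = (a, b) \/ val e = (b, a).
  move=> ab; rewrite /edge; case: ltngtP => [lt|gt|eq].
  - by case: insubP => [e _ ve|]; [exists e => //; left | rewrite /= lt ab].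
  - case: insubP => [e _ ve|]; first by exists e => //; right.
    by rewrite /= gt adj_sym ab.
  - by move: ab; rewrite (val_inj eq) adj_irr.
have u_anti x y : x != y -> u y x = ~~ u x y.
  move=> xy; rewrite /u -opprB lexposN// subr_eq0.
  by apply: contra_neq xy => /inj.
have rel (e f : cedge C) : indep (e, f) ->
    winding (pt (val f).1) (ed e) N (+) winding (pt (val f).2) (ed e) N =
    (winding (pt (val e).1) (ed f) N (+) winding (pt (val e).2) (ed f) N) (+)
    ((u (val f).1 (val e).1 (+) u (val f).2 (val e).1) (+)
     (u (val f).1 (val e).2 (+) u (val f).2 (val e).2)).
  move=> ief; have [_ _ e0E e1E] := arc e; have [_ _ f0E f1E] := arc f.
  have := @winding_relation R (d / 2 / 2) (ed e) (ed f) N isT e0 (HM e) (HM f).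
  rewrite e0E e1E f0E f1E; apply=> i j iN jN.
  rewrite mulrC divfK ?pnatr_eq0//.
  have in01 (k : nat) : (k <= N)%N -> (k%:R / N%:R : R) \in `[0, 1].
    by move=> kN; rewrite in_itv /= divr_ge0//= ler_pdivrMr ?ltr0n// mul1r ler_nat.
  by apply: (far (e, f) ief); exact: in01.
apply: (@no_complete_minor5 _ (@adj C) u w u_anti _ [set: 'I_(nvert C)]%SET).
- move=> a b c d' ab cd ac ad bc bd.
  have [e ee ve] := edgeP _ _ ab; have [f ff vf] := edgeP _ _ cd.
  have ief : indep (e, f).
    by rewrite /indep /=; case: ve => ->; case: vf => -> /=; rewrite ac ad bc bd.
  have := rel e f ief; rewrite /w ee ff.
  case: ve => ->; case: vf => -> //= {}H.
  + by rewrite addbC H [u d' a (+) _]addbC [u d' b (+) _]addbC.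
  + by rewrite H [X in X (+) _]addbC [X in _ (+) X]addbC.
  + rewrite addbC H [X in X (+) _]addbC; congr (_ (+) _).
    by rewrite addbC [u d' a (+) _]addbC [u d' b (+) _]addbC.
- apply: dense_complete_minor; first exact: adj_sym.
  + exact: adj_irr.
  + rewrite -card_gt0 finset.cardsT card_ord.
    case: (posnP (nvert C)) => // n0; exfalso; move: dense; rewrite n0 muln0.
    by case/card_gt0P => e _; have := leq_ltn_trans (leq0n _) (ltn_ord (val e).1); rewrite n0.
  (* Here [k] is 3, as [K_5] is asked for: the required density is [2 ^ 3] arcs per vertex, that is
     4 edges. *)
  + rewrite -card_cedge_arcs finset.cardsT card_ord; lia.
Qed.

End PlanarSparse.

(** * Boxes and polygonal arcs *)

Section PlaneGeometry.
Variable R : realType.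
Notation plane := (R * R)%type.

Lemma continuous_pair (T : topologicalType) (f g : T -> R) (x : T) :
  {for x, continuous f} -> {for x, continuous g} ->
  {for x, continuous (fun t => (f t, g t) : plane)}.
Proof. by move=> cf cg; exact: (cvg_pair cf cg). Qed.

Lemma affine_continuous (a b c : R) :
  continuous (fun q : plane => a * q.1 + b * q.2 + c).
Proof.
move=> q; apply: cvgD; last exact: cvg_cst.
by apply: cvgD; apply: cvgMl_tmp; [exact: cvg_fst | exact: cvg_snd].
Qed.

Lemma affine_map_continuous (a b c a' b' c' : R) :
  continuous (fun q : plane =>
    (a * q.1 + b * q.2 + c, a' * q.1 + b' * q.2 + c') : plane).
Proof. by move=> q; exact: (continuous_pair (@affine_continuous a b c q)
  (@affine_continuous a' b' c' q)). Qed.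

Lemma open_affine_gt0 (a b c : R) :
  open [set q : plane | 0 < a * q.1 + b * q.2 + c].
Proof.
rewrite (_ : [set q : plane | _] =
  (fun q : plane => a * q.1 + b * q.2 + c) @^-1` [set x | 0 < x])//.
by apply: open_comp; [move=> q _; exact: affine_continuous | exact: open_gt].
Qed.

Lemma closed_affine_ge0 (a b c : R) :
  closed [set q : plane | 0 <= a * q.1 + b * q.2 + c].
Proof.
rewrite (_ : [set q : plane | _] =
  (fun q : plane => a * q.1 + b * q.2 + c) @^-1` [set x | 0 <= x])//.
by apply: closed_comp; [move=> q _; exact: affine_continuous | exact: closed_ge].
Qed.

(* A shear straightens a horizontal line and the line of direction [(s, 1)]. *)
Lemma alternate_transverse (A B U : set plane) (p : plane) (s : R) :
  open U -> U p -> (forall q, U q -> (A q <-> q.2 = p.2)) ->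
  (forall q, U q -> (B q <-> q.1 - s * q.2 = p.1 - s * p.2)) ->
  alternate A B p /\ alternate B A p.
Proof.
move=> oU Up AU BU; set c := p.1 - s * p.2.
pose f (q : plane) : plane := (1 * q.1 + (- s) * q.2 + (- c), 0 * q.1 + 1 * q.2 + - p.2).
pose g (q : plane) : plane := (1 * q.1 + s * q.2 + (c + s * p.2), 0 * q.1 + 1 * q.2 + p.2).
pose f' (q : plane) : plane := (0 * q.1 + 1 * q.2 + - p.2, 1 * q.1 + (- s) * q.2 + (- c)).
pose g' (q : plane) : plane := (s * q.1 + 1 * q.2 + (c + s * p.2), 1 * q.1 + 0 * q.2 + p.2).
have fK q : g (f q) = q by case: q => x y; rewrite /f /g /=; congr pair; ring.
have gK q : f (g q) = q by case: q => x y; rewrite /f /g /=; congr pair; ring.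
have fK' q : g' (f' q) = q by case: q => x y; rewrite /f' /g' /=; congr pair; ring.
have gK' q : f' (g' q) = q by case: q => x y; rewrite /f' /g' /=; congr pair; ring.
have H1 q : 1 * q.1 + (- s) * q.2 + (- c) = 0 <-> q.1 - s * q.2 = c.
  by split=> h; lra.
have H2 q : 0 * q.1 + 1 * q.2 + - p.2 = 0 <-> q.2 = p.2.
  by split=> h; lra.
split.
- exists U, (g @^-1` U), f, g; split.
  + split=> //; first by apply: open_comp => // q _; exact: affine_map_continuous.
    by rewrite /f /c; congr pair; ring.
  + by split=> //= x; rewrite ?fK.
  + by split=> q _; exact: affine_map_continuous.
  + by move=> q Uq; rewrite /f /= (AU _ Uq) (BU _ Uq) H1 H2.
- exists U, (g' @^-1` U), f', g'; split.
  + split=> //; first by apply: open_comp => // q _; exact: affine_map_continuous.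
    by rewrite /f' /c; congr pair; ring.
  + by split=> //= x; rewrite ?fK'.
  + by split=> q _; exact: affine_map_continuous.
  + by move=> q Uq; rewrite /f' /= (AU _ Uq) (BU _ Uq) H1 H2.
Qed.

Definition box (l r b t : R) : set plane :=
  [set q | l <= q.1 <= r /\ b <= q.2 <= t].

Definition open_box (l r b t : R) : set plane :=
  [set q | l < q.1 < r /\ b < q.2 < t].

Lemma open_open_box l r b t : open (open_box l r b t).
Proof.
rewrite (_ : open_box l r b t =
  [set q : plane | 0 < 1 * q.1 + 0 * q.2 + - l] `&`
  [set q : plane | 0 < (-1) * q.1 + 0 * q.2 + r] `&`
  ([set q : plane | 0 < 0 * q.1 + 1 * q.2 + - b] `&`
   [set q : plane | 0 < 0 * q.1 + (-1) * q.2 + t])).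
  by apply: openI; apply: openI; exact: open_affine_gt0.
apply/seteqP; split=> q /=; rewrite /open_box /=.
  by move=> [/andP[? ?] /andP[? ?]]; do !split; lra.
by move=> [[? ?] [? ?]]; split; apply/andP; split; lra.
Qed.

Lemma closed_box l r b t : closed (box l r b t).
Proof.
rewrite (_ : box l r b t =
  [set q : plane | 0 <= 1 * q.1 + 0 * q.2 + - l] `&`
  [set q : plane | 0 <= (-1) * q.1 + 0 * q.2 + r] `&`
  ([set q : plane | 0 <= 0 * q.1 + 1 * q.2 + - b] `&`
   [set q : plane | 0 <= 0 * q.1 + (-1) * q.2 + t])).
  by apply: closedI; apply: closedI; exact: closed_affine_ge0.
apply/seteqP; split=> q /=; rewrite /box /=.
  by move=> [/andP[? ?] /andP[? ?]]; do !split; lra.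
by move=> [[? ?] [? ?]]; split; apply/andP; split; lra.
Qed.

Lemma interior_box l r b t : interior (box l r b t) = open_box l r b t.
Proof.
apply/seteqP; split; last first.
  rewrite -open_subsetE; last exact: open_open_box.
  by move=> q [/andP[? ?] /andP[? ?]]; split; apply/andP; split; lra.
move=> [x y] /nbhs_ballP[e /= e0 eB].
have e2 : 0 < e / 2 by rewrite divr_gt0.
have e2e : e / 2 < e by rewrite ltr_pdivrMr// ltr_pMr// ltr1n.
have B (a c : R) : `|a| <= e / 2 -> `|c| <= e / 2 -> box l r b t (x - a, y - c).
  move=> ha hc; apply: eB; rewrite -ball_normE /= prod_normE /= !opprB.
  by rewrite !(addrC _ (_ - _)) !subrK gt_max !(le_lt_trans _ e2e).
have n1 : `|e / 2| <= e / 2 by rewrite gtr0_norm.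
have n2 : `|- (e / 2)| <= e / 2 by rewrite normrN.
have [/andP[/= ? ?] /andP[/= ? ?]] := B _ _ n1 n1.
have [/andP[/= ? ?] /andP[/= ? ?]] := B _ _ n2 n2.
by split=> /=; apply/andP; split; lra.
Qed.

Lemma boundary_box l r b t : boundary (box l r b t) =
  [set q | box l r b t q /\
     [\/ q.1 = l, q.1 = r, q.2 = b | q.2 = t]].
Proof.
rewrite /boundary interior_box -(proj1 (closure_id _) (@closed_box l r b t)).
apply/seteqP; split=> q [] [/andP[? ?] /andP[? ?]].
  move=> H; split; first by split; apply/andP; split.
  have [?|nl] := eqVneq q.1 l; first by constructor 1.
  have [?|nr] := eqVneq q.1 r; first by constructor 2.
  have [?|nb] := eqVneq q.2 b; first by constructor 3.
  have [?|nt] := eqVneq q.2 t; first by constructor 4.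
  exfalso; apply: H; rewrite /open_box /= !lt_neqAle nr nt eq_sym nl (eq_sym b) nb.
  by split; apply/andP; split.
move=> H; split; first by split; apply/andP; split.
by move=> [/andP[? ?] /andP[? ?]]; case: H => ?; lra.
Qed.

Lemma box_connected l r b t : l <= r -> b <= t -> connected (box l r b t).
Proof.
move=> lr bt.
have hor y : connected [set q : plane | l <= q.1 <= r /\ q.2 = y].
  rewrite (_ : [set q : plane | _] = (fun x => (x, y) : plane) @` `[l, r]).
    apply: connected_continuous_connected; first exact: segment_connected.
    apply: continuous_subspaceT => x.
    by apply: (@continuous_pair _ id (cst y)); [exact: cvg_id | exact: cvg_cst].
  apply/seteqP; split=> [[x z] /= [? ->]|_ [x /= + <-]]; first by exists x; rewrite ?in_itv.
  by rewrite in_itv.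
(* The box is a union of combs, each made of the left side and one horizontal segment; all of them
   share the left side. *)
rewrite (_ : box l r b t = \bigcup_(y in `[b, t])
   ([set q : plane | l <= q.1 <= r /\ q.2 = y] `|`
    [set q : plane | q.1 = l /\ b <= q.2 <= t])).
  apply: bigcup_connected.
    by exists (l, b) => y _; right; rewrite /= lexx bt.
  move=> y; rewrite /= in_itv /= => yb; apply: connectedU; last 2 first.
  - exact: hor.
  - rewrite (_ : [set q : plane | _] = (fun x => (l, x) : plane) @` `[b, t]).
      apply: connected_continuous_connected; first exact: segment_connected.
      apply: continuous_subspaceT => x.
      by apply: (@continuous_pair _ (cst l) id); [exact: cvg_cst | exact: cvg_id].
    apply/seteqP; split=> [[x z] /= [-> ?]|_ [x /= + <-]]; first by exists z; rewrite ?in_itv.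
    by rewrite in_itv.
  - by exists (l, y); split=> /=; rewrite ?lexx ?lr.
apply/seteqP; split=> [q [q1 q2]|q [y /=]].
  by exists q.2; [rewrite /= in_itv | left].
rewrite in_itv /= => yb [[? /= qy]|[/= ql ?]]; first by split; rewrite ?qy.
by split; rewrite // ql lexx lr.
Qed.

End PlaneGeometry.

(** * A box is the image of the closed disc under a continuous injection *)

Section DiscToBox.
Variable R : realType.
Notation plane := (R * R)%type.

Definition norm2 (q : plane) : R := Num.sqrt (q.1 ^+ 2 + q.2 ^+ 2).

(* the radial map taking Euclidean circles to circles of the supremum norm *)
Definition square_of_disc (q : plane) : plane := (norm2 q / `|q|) *: q.

Lemma norm2_ge0 q : 0 <= norm2 q.
Proof. exact: sqrtr_ge0. Qed.

Lemma norm2Z (k : R) q : 0 <= k -> norm2 (k *: q) = k * norm2 q.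
Proof.
move=> k0; rewrite /norm2 /= !exprMn -mulrDr sqrtrM ?sqr_ge0//.
by rewrite sqrtr_sqr ger0_norm.
Qed.

Lemma norm2_eq0 q : (norm2 q == 0) = (q == 0).
Proof.
case: q => x y; rewrite sqrtr_eq0 /= le_eqVlt ltNge addr_ge0 ?sqr_ge0//= orbF.
by rewrite paddr_eq0 ?sqr_ge0// !sqrf_eq0.
Qed.

(** For the continuity of [square_of_disc] at the origin, where the quotient of the two norms has no
    limit. *)
Lemma norm2_le q : norm2 q <= 2 * `|q|.
Proof.
have h x y : `|x| <= y -> x ^+ 2 <= y ^+ 2 :> R.
  by move=> xy; rewrite -real_normK ?num_real// lerXn2r ?nnegrE// (le_trans _ xy).
rewrite -[leRHS]ger0_norm ?mulr_ge0// -sqrtr_sqr ler_wsqrtr//.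
have h1 : q.1 ^+ 2 <= `|q| ^+ 2 by apply: h; rewrite prod_normE le_max lexx.
have h2 : q.2 ^+ 2 <= `|q| ^+ 2 by apply: h; rewrite prod_normE le_max lexx orbT.
have := sqr_ge0 `|q|; rewrite exprMn; lra.
Qed.

Lemma norm_square_of_disc q : `|square_of_disc q| = norm2 q.
Proof.
rewrite normrZ ger0_norm ?divr_ge0 ?norm2_ge0//.
have [->|q0] := eqVneq q 0; last by rewrite divfK// normr_eq0.
by apply/eqP; rewrite normr0 mulr0 eq_sym norm2_eq0.
Qed.

Lemma norm2_continuous : continuous norm2.
Proof.
move=> q; apply: (@continuous_comp _ _ _ (fun q : plane => q.1 ^+ 2 + q.2 ^+ 2)).
  apply: cvgD; apply: (@continuous_comp _ _ _ _ (fun x : R => x ^+ 2));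
    [exact: cvg_fst | exact: exprn_continuous | exact: cvg_snd | exact: exprn_continuous].
exact: sqrt_continuous.
Qed.

Lemma square_of_disc_continuous : continuous square_of_disc.
Proof.
move=> q; have [->|q0] := eqVneq q 0.
  apply/cvgrPdist_lt => e e0.
  have s0 : square_of_disc 0 = 0 by rewrite /square_of_disc scaler0.
  rewrite s0; have e2 : 0 < e / 2 by rewrite divr_gt0.
  apply: filterS (nbhsx_ballx (0 : plane) _ e2) => p; rewrite -ball_normE /= !sub0r !normrN => pe.
  rewrite norm_square_of_disc (le_lt_trans (norm2_le p))//.
  by rewrite mulrC -ltr_pdivlMr.
apply: cvgZ; last exact: cvg_id.
apply: cvgM; first exact: norm2_continuous.
apply: cvgV; first by rewrite normr_eq0.
exact: norm_continuous.
Qed.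

Lemma square_of_disc_inj : injective square_of_disc.
Proof.
move=> p q pq; have n2 : norm2 p = norm2 q by rewrite -!norm_square_of_disc pq.
have [p0|p0] := eqVneq p 0.
  by apply/eqP; rewrite p0 eq_sym -norm2_eq0 -n2 norm2_eq0 p0.
have q0 : q != 0 by rewrite -norm2_eq0 -n2 norm2_eq0.
have np : norm2 p != 0 by rewrite norm2_eq0.
have np' : `|p| != 0 by rewrite normr_eq0.
have nq' : `|q| != 0 by rewrite normr_eq0.
(* The Euclidean norm of the image of [p] is [norm2 p ^ 2] divided by the supremum norm of [p], and
   [norm2 p = norm2 q] is already known. Hence both points are scaled by the same factor. *)
have e : `|p| = `|q|.
  have := congr1 norm2 pq; rewrite /square_of_disc !norm2Z ?divr_ge0 ?norm2_ge0//.
  rewrite -n2 => /(mulIf np) /(mulfI np); exact: invr_inj.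
move: pq; rewrite /square_of_disc -n2 e.
by apply: scalerI; rewrite mulf_neq0// invr_neq0.
Qed.

Lemma unit_discE (q : plane) : unit_disc q <-> norm2 q <= 1.
Proof.
have s0 : 0 <= q.1 ^+ 2 + q.2 ^+ 2 by rewrite addr_ge0 ?sqr_ge0.
rewrite /unit_disc /= /norm2; split=> h.
  by rewrite -[leRHS]sqrtr1 ler_wsqrtr.
by rewrite -(sqr_sqrtr s0) expr_le1 ?sqrtr_ge0.
Qed.

Lemma square_of_disc_image :
  square_of_disc @` @unit_disc R = [set q | `|q| <= 1].
Proof.
apply/seteqP; split=> [_ [q + <-]|q /= q1].
  by rewrite unit_discE /= norm_square_of_disc.
have [->|q0] := eqVneq q 0.
  exists 0; last by rewrite /square_of_disc scaler0.
  apply/unit_discE; have /eqP -> : norm2 0 == 0 by rewrite norm2_eq0.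
  exact: ler01.
have n0 : norm2 q != 0 by rewrite norm2_eq0.
have n0' : `|q| != 0 by rewrite normr_eq0.
have k0 : 0 <= `|q| / norm2 q by rewrite divr_ge0 ?norm2_ge0.
exists ((`|q| / norm2 q) *: q).
  by apply/unit_discE; rewrite norm2Z// divfK.
rewrite /square_of_disc norm2Z// normrZ ger0_norm// divfK// scalerA.
rewrite -[RHS]scale1r; congr (_ *: _); field.
by rewrite n0 n0'.
Qed.

Lemma simple_closed_region_box l r b t : l < r -> b < t ->
  simple_closed_region (box l r b t : set plane).
Proof.
move=> lr bt.
pose g (q : plane) : plane := ((r - l) / 2 * q.1 + 0 * q.2 + (l + r) / 2,
   0 * q.1 + (t - b) / 2 * q.2 + (b + t) / 2).
exists (g \o square_of_disc); split.
- apply: continuous_subspaceT => q; apply: continuous_comp.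
    exact: square_of_disc_continuous.
  exact: affine_map_continuous.
- move=> p q _ _ /= [e1 e2]; apply: square_of_disc_inj.
  have h1 : (square_of_disc p).1 = (square_of_disc q).1.
    have k : (r - l) / 2 != 0 by rewrite gt_eqF// divr_gt0// subr_gt0.
    by move: e1; rewrite !mul0r !addr0 => /addIr /(mulfI k).
  have h2 : (square_of_disc p).2 = (square_of_disc q).2.
    have k : (t - b) / 2 != 0 by rewrite gt_eqF// divr_gt0// subr_gt0.
    by move: e2; rewrite !mul0r !add0r => /addIr /(mulfI k).
  by rewrite [LHS]surjective_pairing h1 h2 -surjective_pairing.
- rewrite -image_comp square_of_disc_image; apply/seteqP; split.
    move=> _ [[x y] + <-]; rewrite /= prod_normE /= ge_max !ler_norml.
    move=> /andP[/andP[x1 x2] /andP[y1 y2]].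
    by split=> /=; apply/andP; split; nra.
  move=> [x y] [/= /andP[x1 x2] /andP[y1 y2]].
  have lr0 : 0 < r - l by rewrite subr_gt0.
  have bt0 : 0 < t - b by rewrite subr_gt0.
  exists ((2 * x - l - r) / (r - l), (2 * y - b - t) / (t - b)).
    rewrite /= prod_normE /= ge_max !ler_norml.
    rewrite !ler_pdivrMr// !ler_pdivlMr//.
    by apply/andP; split; apply/andP; split; lra.
  rewrite /g /=; congr pair; field; rewrite ?gt_eqF//.
Qed.

End DiscToBox.

(** * The arcs with three segments that draw the edges *)

Section Tents.
Variable R : realType.
Notation plane := (R * R)%type.

(** Minima and maxima of affine functions make continuity immediate. On the three thirds of the unit
    interval the arc goes up, across and down. *)
Definition tent_up (t : R) : R := Num.min 1 (Num.min (3 * t) (3 * (1 - t))).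
Definition tent_across (t : R) : R := Num.max 0 (Num.min 1 (3 * t - 1)).

Definition tent (a b s h t : R) : plane :=
  (a + (b - a) * tent_across t + s * (h * tent_up t), h * tent_up t).

(** On the third piece [x] is measured backwards from the end point, so that on both legs it is the
    fraction of the height. *)
Variant tent_spec t : R -> R -> Type :=
| TentLeft x of t = x / 3 & 0 <= x <= 1 : tent_spec t x 0
| TentTop x of t = (1 + x) / 3 & 0 <= x <= 1 : tent_spec t 1 x
| TentRight x of t = 1 - x / 3 & 0 <= x <= 1 : tent_spec t x 1.

Lemma tentP t : 0 <= t <= 1 -> tent_spec t (tent_up t) (tent_across t).
Proof.
move=> /andP[t0 t1]; rewrite /tent_up /tent_across.
have [h|h] := leP (3 * t) 1.
  have -> : Num.min (3 * t) (3 * (1 - t)) = 3 * t by apply/min_idPl; lra.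
  have -> : Num.min 1 (3 * t) = 3 * t by apply/min_idPr.
  have -> : Num.min 1 (3 * t - 1) = 3 * t - 1 by apply/min_idPr; lra.
  have -> : Num.max 0 (3 * t - 1) = 0 by apply/max_idPl; lra.
  by apply: TentLeft; [field | apply/andP; split; lra].
have [h'|h'] := leP (3 * t) 2.
  have -> : Num.min 1 (Num.min (3 * t) (3 * (1 - t))) = 1.
    by apply/min_idPl; rewrite le_min; apply/andP; split; lra.
  have -> : Num.min 1 (3 * t - 1) = 3 * t - 1 by apply/min_idPr; lra.
  have -> : Num.max 0 (3 * t - 1) = 3 * t - 1 by apply/max_idPr; lra.
  by apply: TentTop; [field | apply/andP; split; lra].
have -> : Num.min (3 * t) (3 * (1 - t)) = 3 * (1 - t) by apply/min_idPr; lra.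
have -> : Num.min 1 (3 * (1 - t)) = 3 * (1 - t) by apply/min_idPr; lra.
have -> : Num.min 1 (3 * t - 1) = 1 by apply/min_idPl; lra.
have -> : Num.max 0 1 = 1 :> R by apply/max_idPr.
by apply: TentRight; [field | apply/andP; split; lra].
Qed.

Lemma tent_left a b s h x : 0 <= x <= 1 -> tent a b s h (x / 3) = (a + s * (h * x), h * x).
Proof.
move=> x01; rewrite /tent; case: tentP => [|y e y01|y e y01|y e y01].
- by move: x01 => /andP[? ?]; apply/andP; split; lra.
- by rewrite (_ : x = y); [congr pair; ring | lra].
- have -> : y = 0 by lra.
  by rewrite (_ : x = 1); [congr pair; ring | lra].
- by exfalso; lra.
Qed.

Lemma tent_top a b s h x : 0 <= x <= 1 ->
  tent a b s h ((1 + x) / 3) = (a + (b - a) * x + s * h, h).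
Proof.
move=> x01; rewrite /tent; case: tentP => [|y e y01|y e y01|y e y01].
- by move: x01 => /andP[? ?]; apply/andP; split; lra.
- have -> : y = 1 by lra.
  by rewrite (_ : x = 0); [congr pair; ring | lra].
- have -> : y = x by lra.
  by congr pair; ring.
- have -> : y = 1 by lra.
  by rewrite (_ : x = 1); [congr pair; ring | lra].
Qed.

Lemma tent_right a b s h x : 0 <= x <= 1 ->
  tent a b s h (1 - x / 3) = (b + s * (h * x), h * x).
Proof.
move=> x01; rewrite /tent; case: tentP => [|y e y01|y e y01|y e y01].
- by move: x01 => /andP[? ?]; apply/andP; split; lra.
- by exfalso; lra.
- have -> : y = 1 by lra.
  by rewrite (_ : x = 1); [congr pair; ring | lra].
- have -> : y = x by lra.
  by congr pair; ring.
Qed.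

Lemma tent_continuous a b s h : continuous (tent a b s h).
Proof.
have aff (c d : R) : continuous (fun t : R => c * t + d).
  by move=> t; apply: cvgD; [apply: cvgMl_tmp; exact: cvg_id | exact: cvg_cst].
have cst (c : R) : continuous (fun _ : R => c) by move=> t; exact: cvg_cst.
have up : continuous tent_up.
  rewrite (_ : tent_up = (fun=> 1) \min ((fun t => 3 * t + 0) \min (fun t => - 3 * t + 3))).
    apply: min_fun_continuous; first exact: cst.
    by apply: min_fun_continuous; exact: aff.
  by apply/funext => t; rewrite /tent_up /=; congr (Num.min _ (Num.min _ _)); ring.
have across : continuous tent_across.
  rewrite (_ : tent_across = (fun=> 0) \max ((fun=> 1) \min (fun t => 3 * t + (- 1))))//.
  apply: max_fun_continuous; first exact: cst.
  by apply: min_fun_continuous; [exact: cst | exact: aff].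
move=> t; apply: (@continuous_pair _ _ (fun t => a + (b - a) * tent_across t + s * (h * tent_up t))
  (fun t => h * tent_up t)).
  apply: cvgD.
    by apply: cvgD; [exact: cvg_cst | apply: cvgMl_tmp; exact: across].
  by apply: cvgMl_tmp; apply: cvgMl_tmp; exact: up.
by apply: cvgMl_tmp; exact: up.
Qed.

(** The second coordinate determines [tent_up], which fixes the shift in the first one, and [a != b]
    then gives [tent_across]. These two values determine the parameter. *)
Lemma tent_inj a b s h : a != b -> 0 < h -> {in `[0, 1] &, injective (tent a b s h)}.
Proof.
move=> ab h0 t t'; rewrite !in_itv /= => t01 t01' [+ e2].
have {}e2 := mulfI (lt0r_neq0 h0) e2; rewrite e2 => /addIr /addrI.
have ba : b - a != 0 by rewrite subr_eq0 eq_sym.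
move=> /(mulfI ba); move: e2.
by case: tentP => // x -> ?; case: tentP => // y -> ? ? ?; lra.
Qed.

Definition tent_set (a b s h : R) : set plane := [set q |
  [\/ q.1 = a + s * q.2 /\ 0 <= q.2 <= h, q.1 = b + s * q.2 /\ 0 <= q.2 <= h |
      q.2 = h /\ (a <= q.1 - s * h <= b \/ b <= q.1 - s * h <= a)]].

Lemma closed_arc_tent a b s h : a != b -> 0 < h ->
  closed_arc (tent a b s h) = tent_set a b s h.
Proof.
move=> ab h0; have ba : b - a != 0 by rewrite subr_eq0 eq_sym.
apply/seteqP; split=> [_ [t /= + <-]|[x y]].
  rewrite in_itv /= => t01; rewrite /tent_set /tent /=.
  case: tentP => // z _ /andP[z0 z1].
  - by constructor 1; split; [ring | apply/andP; split; nra].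
  - constructor 3; split; first by rewrite mulr1.
    rewrite mulr1 addrK; case: (leP a b) => [aleb|blta]; [left|right];
    by apply/andP; split; nra.
  - by constructor 2; split; [ring | apply/andP; split; nra].
have yh z : 0 <= z <= h -> 0 <= z / h <= 1.
  by move=> /andP[z0 z1]; rewrite divr_ge0 ?(ltW h0)//= ler_pdivrMr// mul1r.
have in01 (z : R) : 0 <= z <= 1 -> z \in `[0, 1] by rewrite in_itv.
have hK z : h * (z / h) = z by rewrite mulrC divfK// gt_eqF.
case=> /= -[xE yE].
- have y01 := yh _ yE; exists (y / h / 3); last by rewrite tent_left// hK xE.
  by apply: in01; move: y01 => /andP[? ?]; apply/andP; split; lra.
- have y01 := yh _ yE; exists (1 - y / h / 3); last by rewrite tent_right// hK xE.
  by apply: in01; move: y01 => /andP[? ?]; apply/andP; split; lra.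
- pose z := (x - s * h - a) / (b - a).
  have zE : (b - a) * z = x - s * h - a by rewrite mulrC divfK.
  have z01 : 0 <= z <= 1.
    case: yE => /andP[h1 h2].
      have lt : 0 < b - a by rewrite lt0r ba /= subr_ge0 (le_trans h1).
      by rewrite ler_pdivlMr// ler_pdivrMr//; apply/andP; split; lra.
    have lt : b - a < 0 by rewrite lt_neqAle ba /= subr_le0 (le_trans h1).
    by rewrite ler_ndivlMr// ler_ndivrMr//; apply/andP; split; lra.
  exists ((1 + z) / 3); last by rewrite tent_top// zE xE; congr pair; ring.
  by apply: in01; move: z01 => /andP[? ?]; apply/andP; split; lra.
Qed.

Lemma open_arc_tent a b s h : a != b -> 0 < h ->
  open_arc (tent a b s h) = [set q | tent_set a b s h q /\ 0 < q.2].
Proof.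
move=> ab h0; rewrite -closed_arc_tent//.
apply/seteqP; split=> [_ [t + <-]|_ [[t /= + <-]]]; rewrite /= !in_itv /=.
  move=> /andP[t0 t1]; split.
    by exists t => //; rewrite /= in_itv /= !ltW.
  apply: mulr_gt0 => //; case: tentP => [|x tx ?|x tx ?|x tx ?] //; first by rewrite !ltW.
    by lra.
  by lra.
move=> t01; rewrite pmulr_rgt0// => up0; exists t => //=; rewrite in_itv /=.
move: up0; case: tentP => // x tx /andP[? ?] ?; apply/andP; split; lra.
Qed.

Lemma segment_hor (x1 x2 y : R) : segment (x1, y) (x2, y) =
  [set q | q.2 = y /\ (x1 <= q.1 <= x2 \/ x2 <= q.1 <= x1)].
Proof.
apply/seteqP; split=> [_ [t /= + <-]|[x z] /=].
  rewrite in_itv /= => /andP[t0 t1]; split; first by ring.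
  by case: (leP x1 x2) => h; [left|right]; apply/andP; split; nra.
move=> [-> h]; have [e|ne] := eqVneq x1 x2.
  by exists 0; rewrite /= ?in_itv /= ?lexx ?ler01//; congr pair;
    [case: h => /andP[? ?]; lra | ring].
have ba : x2 - x1 != 0 by rewrite subr_eq0 eq_sym.
pose t := (x - x1) / (x2 - x1); have tE : (x2 - x1) * t = x - x1 by rewrite mulrC divfK.
exists t; last first.
  congr pair; last by rewrite /=; ring.
  have e : (1 - t) * x1 + t * x2 = (x2 - x1) * t + x1 by ring.
  by rewrite /= e tE subrK.
rewrite /= in_itv /=; case: h => /andP[h1 h2].
  have lt : 0 < x2 - x1 by rewrite lt0r ba /= subr_ge0 (le_trans h1).
  by rewrite ler_pdivlMr// ler_pdivrMr//; apply/andP; split; lra.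
have lt : x2 - x1 < 0 by rewrite lt_neqAle ba /= subr_le0 (le_trans h1).
by rewrite ler_ndivlMr// ler_ndivrMr//; apply/andP; split; lra.
Qed.

Lemma segment_ver (x y1 y2 : R) : segment (x, y1) (x, y2) =
  [set q | q.1 = x /\ (y1 <= q.2 <= y2 \/ y2 <= q.2 <= y1)].
Proof.
apply/seteqP; split=> [_ [t /= t01 <-]|[z y] /= [-> h]].
  (* The horizontal case is reused after exchanging the coordinates. *)
  have : segment (y1, x) (y2, x) ((1 - t) * y1 + t * y2, (1 - t) * x + t * x) by exists t.
  by rewrite segment_hor.
have : segment (y1, x) (y2, x) (y, x) by rewrite segment_hor.
by move=> [t t01 /= [e1 e2]]; exists t => //=; rewrite e1 e2.
Qed.

Lemma polyline_tent a b s h : a != b -> 0 < h ->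
  polyline (a, 0) [:: (a + s * h, h); (b + s * h, h); (b, 0)] =
  closed_arc (tent a b s h).
Proof.
move=> ab h0; apply/seteqP; split=> q /=.
  move=> [[t + <-]|[[t + <-]|[[t + <-]|->]]]; rewrite /= ?in_itv /=.
  - move=> t01; exists (t / 3); last by rewrite tent_left//; congr pair; ring.
    by rewrite /= in_itv /=; move: t01 => /andP[? ?]; apply/andP; split; lra.
  - move=> t01; exists ((1 + t) / 3); last by rewrite tent_top//; congr pair; ring.
    by rewrite /= in_itv /=; move: t01 => /andP[? ?]; apply/andP; split; lra.
  - move=> t01; have t01' : 0 <= 1 - t <= 1.
      by move: t01 => /andP[? ?]; apply/andP; split; lra.
    exists (1 - (1 - t) / 3); last by rewrite tent_right//; congr pair; ring.
    by rewrite /= in_itv /=; move: t01 => /andP[? ?]; apply/andP; split; lra.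
  - exists (1 - 0 / 3); last by rewrite tent_right ?lexx ?ler01//; congr pair; ring.
    by rewrite /= in_itv /=; apply/andP; split; lra.
move=> [t + <-]; rewrite /= in_itv /= /tent => t01; case: (tentP t01) => x _ x01.
- by left; exists x; rewrite /= ?in_itv//=; congr pair; ring.
- by right; left; exists x; rewrite /= ?in_itv//=; congr pair; ring.
- right; right; left; exists (1 - x); last by rewrite /=; congr pair; ring.
  by rewrite /= in_itv /=; move: x01 => /andP[? ?]; apply/andP; split; lra.
Qed.

Lemma polyline_box (l r b t : R) : l <= r -> b <= t ->
  polyline (l, b) [:: (r, b); (r, t); (l, t); (l, b)] = boundary (box l r b t).
Proof.
move=> lr bt; rewrite /= !segment_hor !segment_ver boundary_box.
apply/seteqP; split=> q /=.
  move=> [[q2 q1]|[[q1 q2]|[[q2 q1]|[[q1 q2]|->]]]]; split.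
  + by split; apply/andP; split; first [case: q1 => /andP[? ?]; lra
      | case: q2 => /andP[? ?]; lra | lra].
  + by constructor 3.
  + by split; apply/andP; split; first [case: q1 => /andP[? ?]; lra
      | case: q2 => /andP[? ?]; lra | lra].
  + by constructor 2.
  + by split; apply/andP; split; first [case: q1 => /andP[? ?]; lra
      | case: q2 => /andP[? ?]; lra | lra].
  + by constructor 4.
  + by split; apply/andP; split; first [case: q1 => /andP[? ?]; lra
      | case: q2 => /andP[? ?]; lra | lra].
  + by constructor 1.
  + by rewrite /box /= !lexx lr bt.
  + by constructor 1.
move=> [[q1 q2]] [e|e|e|e].
- by right; right; right; left; split=> //; right.
- by right; left; split=> //; left.
- by left; split=> //; left.
- by right; right; left; split=> //; right.
Qed.

End Tents.

(** * The drawing *)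

Section Layout.
Variables (R : realType) (C : cgraph).
Notation plane := (R * R)%type.
Variables (vx vw : 'I_(nvert C) -> R) (left right top : 'I_(nclus C) -> R).
Variables (slope height : cedge C -> R).

(* [vw v] is the width of a strip, starting at [vx v], that contains all the
   oblique segments issued from [v] *)
Hypothesis vw_ge0 : forall v, 0 <= vw v.
Hypothesis vertex_apart : forall v w, v != w ->
  vx v + vw v < vx w \/ vx w + vw w < vx v.
Hypothesis slope_ge0 : forall e, 0 <= slope e.
Hypothesis slope_inj : forall e f, e != f -> slope e != slope f.
Hypothesis height_gt0 : forall e, 0 < height e.
Hypothesis height_inj : forall e f, e != f -> height e != height f.
Hypothesis slope_height : forall e v, slope e * height e <= vw v.
Hypothesis top_gt0 : forall mu, 0 < top mu.
Hypothesis left_right : forall mu, left mu < right mu.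
Hypothesis vertex_in : forall mu v, ancestor mu (inl v) ->
  left mu < vx v /\ vx v + vw v < right mu.
Hypothesis vertex_out : forall mu v, ~~ ancestor mu (inl v) ->
  vx v + vw v < left mu \/ right mu < vx v.
Hypothesis box_nested : forall mu nu, ancestor nu (inr mu) -> mu != nu ->
  [/\ left nu < left mu, right mu < right nu & top mu < top nu].
Hypothesis box_apart : forall mu nu, unrelated mu nu ->
  right mu < left nu \/ right nu < left mu.
Hypothesis edge_in : forall (e : cedge C) mu, ancestor mu (inl (val e).1) ->
  ancestor mu (inl (val e).2) -> height e < top mu.
Hypothesis edge_out : forall (e : cedge C) mu,
  ~~ (ancestor mu (inl (val e).1) && ancestor mu (inl (val e).2)) ->
  [\/ top mu < height e,
      right mu < vx (val e).1 /\ right mu < vx (val e).2 |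
      vx (val e).1 + vw (val e).1 < left mu /\
      vx (val e).2 + vw (val e).2 < left mu].

(** The rectangles are symmetric about the x-axis so that the vertices on it are interior points,
    while the open edges stay strictly above it. *)
Definition layout : drawing R C := Drawing
  (fun v => (vx v, 0))
  (fun e => tent (vx (val e).1) (vx (val e).2) (slope e) (height e))
  (fun mu => box (left mu) (right mu) (- top mu) (top mu)).

Let ends (e : cedge C) (v : 'I_(nvert C)) := v = (val e).1 \/ v = (val e).2.

Definition on_leg (e : cedge C) v (q : plane) :=
  q.1 = vx v + slope e * q.2 /\ 0 < q.2 <= height e.

Definition on_top (e : cedge C) (q : plane) := q.2 = height e /\
  (vx (val e).1 <= q.1 - slope e * height e <= vx (val e).2 \/
   vx (val e).2 <= q.1 - slope e * height e <= vx (val e).1).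

Let vx_inj v w : v != w -> vx v != vx w.
Proof.
move=> ne; apply/eqP => e; have := vw_ge0 v; have := vw_ge0 w.
by case: (vertex_apart ne); lra.
Qed.

Let ends_neq (e : cedge C) : vx (val e).1 != vx (val e).2.
Proof.
by apply: vx_inj; have /andP[lt _] := valP e; rewrite -val_eqE /= neq_ltn lt.
Qed.

Let edgeP e q : open_arc (dedge layout e) q <->
  (exists2 v, ends e v & on_leg e v q) \/ on_top e q.
Proof.
rewrite open_arc_tent//; split.
  move=> [[[q1 /andP[_ q2]]|[q1 /andP[_ q2]]|[q2 q1]] q0].
  - by left; exists (val e).1; [left | split=> //; rewrite q0].
  - by left; exists (val e).2; [right | split=> //; rewrite q0].
  - by right.
move=> [[v [->|->] [q1 /andP[q0 q2]]]|[q2 q1]]; split=> //.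
- by constructor 1; rewrite q2 ltW.
- by constructor 2; rewrite q2 ltW.
- by constructor 3.
- by rewrite q2.
Qed.

Let leg_range e v q : on_leg e v q -> vx v <= q.1 <= vx v + vw v.
Proof.
move=> [-> /andP[q0 qh]]; rewrite lerDl mulr_ge0 ?(ltW q0)//= lerD2l.
by apply: le_trans (slope_height e v); rewrite ler_wpM2l.
Qed.

Let top_range e q : on_top e q ->
  (vx (val e).1 <= q.1 \/ vx (val e).2 <= q.1) /\
  (q.1 <= vx (val e).1 + vw (val e).1 \/ q.1 <= vx (val e).2 + vw (val e).2).
Proof.
move=> [_ h]; have := slope_height e (val e).1; have := slope_height e (val e).2.
have : 0 <= slope e * height e by rewrite mulr_ge0// ltW.
by case: h => /andP[? ?] ? ? ?; split; [left|right|right|left]; lra.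
Qed.

(** Legs of one vertex have different slopes and meet only at height 0; legs of different vertices
    lie in disjoint strips. *)
Let legs_apart e f v w q : e != f -> on_leg e v q -> on_leg f w q -> False.
Proof.
move=> ef lv lw; have [vw'|ne] := eqVneq v w.
  move: lv lw => [+ /andP[q0 _]] [+ _]; rewrite vw' => -> /addrI /mulIf.
  rewrite gt_eqF// => /(_ isT) e'; by have := slope_inj ef; rewrite e' eqxx.
have /andP[? ?] := leg_range lv; have /andP[? ?] := leg_range lw.
by case: (vertex_apart ne); lra.
Qed.

(** Two legs cannot meet and two horizontal parts have different heights. The last clause of each
    case says that the meeting point is not a corner of the flat edge, as corners belong to legs. *)
Let edge_edge e f q : e != f -> open_arc (dedge layout e) q ->
  open_arc (dedge layout f) q ->
  (exists2 v, ends e v & [/\ on_leg e v q, q.2 < height e, on_top f q &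
     forall w, ~ on_leg f w q]) \/
  (exists2 v, ends f v & [/\ on_leg f v q, q.2 < height f, on_top e q &
     forall w, ~ on_leg e w q]).
Proof.
move=> ef /edgeP[[v ev lv]|te] /edgeP[[w fw lw]|tf].
- by case: (legs_apart ef lv lw).
- left; exists v => //; split=> //.
    have [_ /andP[_ qh]] := lv; rewrite lt_neqAle qh andbT.
    by have [-> _] := tf; rewrite eq_sym height_inj.
  by move=> w lw; exact: legs_apart ef lv lw.
- right; exists w => //; split=> //.
    have [_ /andP[_ qh]] := lw; rewrite lt_neqAle qh andbT.
    by have [-> _] := te; rewrite height_inj.
  by move=> v lv; exact: legs_apart ef lv lw.
- have [te' _] := te; have [tf' _] := tf.
  by have := height_inj ef; rewrite -te' -tf' eqxx.
Qed.

(** With both ends in the cluster the edge stays strictly inside the box. Otherwise its horizontal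
    part passes above the box or beside it, and a leg of an outer vertex keeps to a strip away from
    the box. Only the leg of an inner vertex can leave, and it does so through the top side. *)
Let edge_region e mu q : open_arc (dedge layout e) q ->
  boundary (dregion layout mu) q ->
  exists2 v, ends e v & [/\ on_leg e v q, q.2 < height e, q.2 = top mu,
    ancestor mu (inl v) & left mu < q.1 < right mu /\
    ~~ (ancestor mu (inl (val e).1) && ancestor mu (inl (val e).2))].
Proof.
move=> /edgeP eq; rewrite boundary_box => -[[/andP[q1l q1r] /andP[q2b q2t]] side].
case: eq => [[v ev lv]|te].
  have /andP[r1 r2] := leg_range lv; have [_ /andP[q0 qh]] := lv.
  have [vin|vout] := boolP (ancestor mu (inl v)); last first.
    by case: (vertex_out vout); lra.
  have [v1 v2] := vertex_in vin; have w0 := vw_ge0 v.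
  have qt : q.2 = top mu by have := top_gt0 mu; case: side => // ?; lra.
  have nin : ~~ (ancestor mu (inl (val e).1) && ancestor mu (inl (val e).2)).
    by apply/negP => /andP[i1 i2]; have := edge_in i1 i2; lra.
  exists v => //; split=> //; last by split=> //; apply/andP; split; lra.
  case: (edge_out nin) => [lt|[lt1 lt2]|[lt1 lt2]]; first by rewrite qt.
  - have lt : right mu < vx v by case: ev => ->.
    by exfalso; lra.
  - have lt : vx v + vw v < left mu by case: ev => ->.
    by exfalso; lra.
have [r1 r2] := top_range te; have [th _] := te; have h0 := height_gt0 e.
have [/andP[i1 i2]|nin] :=
    boolP (ancestor mu (inl (val e).1) && ancestor mu (inl (val e).2)).
  have ht := edge_in i1 i2; have [a1 b1] := vertex_in i1.
  have [a2 b2] := vertex_in i2.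
  have ql : left mu < q.1.
    by case: r1 => r1; [exact: lt_le_trans a1 r1 | exact: lt_le_trans a2 r1].
  have qr : q.1 < right mu.
    by case: r2 => r2; [exact: le_lt_trans r2 b1 | exact: le_lt_trans r2 b2].
  exfalso.
  by case: side => ?; lra.
exfalso; case: (edge_out nin) => [lt|[lt1 lt2]|[lt1 lt2]].
- by lra.
- by case: r1 => ?; lra.
- by case: r2 => ?; lra.
Qed.

Let region_region mu nu q : mu != nu -> boundary (dregion layout mu) q ->
  boundary (dregion layout nu) q -> False.
Proof.
rewrite !boundary_box => ne [[/andP[? ?] /andP[? ?]] sm] [[/andP[? ?] /andP[? ?]] sn].
have [nm|nnm] := boolP (ancestor nu (inr mu)).
  by have [? ? ?] := box_nested nm ne; case: sn => ?; lra.
have [mn|nmn] := boolP (ancestor mu (inr nu)).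
  by rewrite eq_sym in ne; have [? ? ?] := box_nested mn ne; case: sm => ?; lra.
have unr : unrelated mu nu by rewrite /unrelated nnm nmn.
by case: (box_apart unr) => ?; lra.
Qed.

(** At a meeting point exactly one of the two curves is at its own level, the other being strictly
    below it. This is what excludes triple points. *)
Let level (i : cedge C + 'I_(nclus C)) : R :=
  match i with inl e => height e | inr mu => top mu end.

Let slope_at (i : cedge C + 'I_(nclus C)) : R :=
  if i is inl e then slope e else 0.

(** Local normal forms of a curve at a point. Every crossing pairs an oblique curve with a flat one,
    which is the situation straightened by the shear of [alternate_transverse]. *)
Let oblique_at (i : cedge C + 'I_(nclus C)) (p : plane) := exists2 U : set plane,
  open U /\ U p & forall q, U q ->
    (dcurve layout i q <-> q.1 - slope_at i * q.2 = p.1 - slope_at i * p.2).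
Let flat_at (i : cedge C + 'I_(nclus C)) (p : plane) := exists2 U : set plane,
  open U /\ U p & forall q, U q -> (dcurve layout i q <-> q.2 = p.2).

Let leg_oblique e v p : ends e v -> on_leg e v p -> p.2 < height e ->
  oblique_at (inl e) p.
Proof.
move=> ev [p1 /andP[p0 _]] ph.
have [w [wv ew]] : exists w, vx w != vx v /\
    forall u, ends e u -> u = v \/ u = w.
  case: ev => ->; [exists (val e).2 | exists (val e).1].
    by rewrite eq_sym ends_neq; split.
  by rewrite ends_neq; split=> // u [] ->; [right|left].
(* [U] must avoid the horizontal part and the other leg of the edge. The sign [k] selects the side
   of the line of that other leg on which [p] lies. *)
pose k : R := if vx v < vx w then 1 else - 1.
pose U : set plane := [set q | 0 < 0 * q.1 + 1 * q.2 + 0] `&`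
  [set q | 0 < 0 * q.1 + (- 1) * q.2 + height e] `&`
  [set q | 0 < (- k) * q.1 + (k * slope e) * q.2 + k * vx w].
have kp : 0 < k * (vx w - vx v).
  rewrite /k; have [lt|gt|eq] := ltgtP (vx v) (vx w).
  - by rewrite mul1r subr_gt0.
  - by rewrite mulN1r opprB subr_gt0.
  - by move: wv; rewrite eq eqxx.
exists U.
  split; first by do 2?apply: openI; exact: open_affine_gt0.
  do !split; rewrite /=; [lra | lra |].
  by rewrite p1 (_ : _ + _ = k * (vx w - vx v))//; ring.
move=> q [[q0 qh] qw]; rewrite /= in q0 qh qw.
rewrite /dcurve edgeP /slope_at p1 addrK; split.
  move=> [[u /ew[->|->] [q1 _]]|[q2 _]]; last by exfalso; lra.
    by rewrite q1 addrK.
  exfalso; suff : (- k) * q.1 + (k * slope e) * q.2 + k * vx w = 0 by lra.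
  by rewrite q1; ring.
move=> q1; left; exists v => //; split; first by rewrite -q1 subrK.
by apply/andP; split; lra.
Qed.

Let top_flat e p : on_top e p -> (forall v, ~ on_leg e v p) -> flat_at (inl e) p.
Proof.
move=> [ph pb] nl; have h0 := height_gt0 e.
pose a := vx (val e).1; pose b := vx (val e).2; pose s := slope e.
have na v : p.1 - s * height e != vx v.
  apply/eqP => pv; apply: (nl v); split; last by rewrite ph h0 lexx.
  by rewrite ph -pv subrK.
(* Sheared abscissae: both legs become vertical lines, at [lo] and [hi], and [p] lies strictly
   between them because it is not a corner. *)
have : exists lo hi, [/\ lo < p.1 - s * height e < hi,
   forall q : plane, lo < q.1 - s * q.2 < hi -> q.2 = height e -> on_top e q &
   forall (q : plane) v, ends e v -> q.1 - s * q.2 = vx v -> ~ (lo < q.1 - s * q.2 < hi)].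
  case: pb => /andP[p1 p2]; [exists a, b | exists b, a]; split.
  - by rewrite !lt_neqAle p1 p2 (eq_sym a) !na.
  - move=> q /andP[q1 q2] qh; split=> //; left; rewrite -qh.
    by apply/andP; split; apply: ltW.
  - by move=> q v [->|->] ->; rewrite ltxx ?andbF.
  - by rewrite !lt_neqAle p1 p2 (eq_sym b) !na.
  - move=> q /andP[q1 q2] qh; split=> //; right; rewrite -qh.
    by apply/andP; split; apply: ltW.
  - by move=> q v [->|->] ->; rewrite ltxx ?andbF.
move=> [lo [hi [/andP[lop hip] tq lq]]].
exists ([set q | 0 < 1 * q.1 + (- s) * q.2 + - lo] `&`
        [set q | 0 < (- 1) * q.1 + s * q.2 + hi]).
  split; first by apply: openI; exact: open_affine_gt0.
  by split; rewrite /= ph; lra.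
move=> q [q1 q2]; rewrite /= in q1 q2.
have qb : lo < q.1 - s * q.2 < hi by apply/andP; split; lra.
rewrite /dcurve edgeP ph; split.
  move=> [[v ev [qv _]]|[//]]; case: (lq q v ev) => //.
  by rewrite qv addrK.
by move=> qh; right; apply: tq.
Qed.

Let boundary_flat mu p : p.2 = top mu -> left mu < p.1 < right mu ->
  flat_at (inr mu) p.
Proof.
move=> pt /andP[pl pr]; have t0 := top_gt0 mu.
exists ([set q | 0 < 1 * q.1 + 0 * q.2 + - left mu] `&`
        [set q | 0 < (- 1) * q.1 + 0 * q.2 + right mu] `&`
        [set q | 0 < 0 * q.1 + 1 * q.2 + 0]).
  split; first by do 2?apply: openI; exact: open_affine_gt0.
  by do !split; rewrite /= ?pt; lra.
move=> q [[q1 q2] q3]; rewrite /= in q1 q2 q3.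
rewrite /dcurve boundary_box pt; split.
  by move=> [_ [?|?|?|//]]; lra.
by move=> qt; split; [split; apply/andP; split; lra | constructor 4].
Qed.

Let curves_meet i j p : i != j -> dcurve layout i p -> dcurve layout j p ->
  [/\ oblique_at i p, flat_at j p, p.2 < level i & p.2 = level j] \/
  [/\ oblique_at j p, flat_at i p, p.2 < level j & p.2 = level i].
Proof.
case: i j => [e|mu] [f|nu] ij ip jp.
- have ef : e != f by apply: contra_neq ij => ->.
  case: (edge_edge ef ip jp) => -[v ev [lv lh tf nl]]; [left|right]; split=> //.
  + exact: leg_oblique ev lv lh.
  + exact: top_flat.
  + by case: tf.
  + exact: leg_oblique ev lv lh.
  + exact: top_flat.
  + by case: tf.
- have [v ev [lv lh qt _ [qlr _]]] := edge_region ip jp; left; split=> //.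
    exact: leg_oblique ev lv lh.
  exact: boundary_flat.
- have [v ev [lv lh qt _ [qlr _]]] := edge_region jp ip; right; split=> //.
    exact: leg_oblique ev lv lh.
  exact: boundary_flat.
- by case: (@region_region mu nu p) => //; apply: contra_neq ij => ->.
Qed.

Let oblique_flat_alternate i j p : oblique_at i p -> flat_at j p ->
  alternate (dcurve layout i) (dcurve layout j) p /\
  alternate (dcurve layout j) (dcurve layout i) p.
Proof.
move=> [U [oU Up] UP] [V [oV Vp] VP].
have [] := @alternate_transverse R (dcurve layout j) (dcurve layout i) (U `&` V) p
  (slope_at i); last by [].
- exact: openI.
- by [].
- by move=> q [_ /VP].
- by move=> q [/UP].
Qed.

Let leg_point (e : cedge C) v (y : R) : plane := (vx v + slope e * y, y).

(** The edges meet only where a leg of the higher one passes the height of the lower one, which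
    leaves one candidate for each of the two legs. *)
Let edge_edge_sub e f : e != f -> exists p q : plane,
  open_arc (dedge layout e) `&` open_arc (dedge layout f) `<=` [set p; q].
Proof.
move=> ef; wlog lt : e f ef / height f < height e.
  move=> H; have := height_inj ef; rewrite neq_lt => /orP[lt|lt]; last exact: H.
  by rewrite setIC; apply: H => //; rewrite eq_sym.
exists (leg_point e (val e).1 (height f)), (leg_point e (val e).2 (height f)).
move=> q [eq fq]; case: (edge_edge ef eq fq) => -[v ev [[q1 _] qh [q2 _] _]].
  have -> : q = leg_point e v (height f) by case: q q1 q2 {eq fq qh} => x y /= -> ->.
  by case: ev => ->; [left|right].
by exfalso; lra.
Qed.

(** A crossing requires exactly one end in the cluster, and the only candidate is the point of its
    leg at the height of the top side. *)
Let edge_region_sub e mu : exists p : plane,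
  open_arc (dedge layout e) `&` boundary (dregion layout mu) `<=` [set p].
Proof.
exists (leg_point e (if ancestor mu (inl (val e).1) then (val e).1 else (val e).2)
  (top mu)).
move=> q [eq mq].
have [v ev [[q1 _] _ q2 av [_ nb]]] := edge_region eq mq.
have -> : q = leg_point e v (top mu) by case: q q1 q2 {eq mq} => x y /= -> ->.
case: ev av nb => -> av; first by rewrite av.
by rewrite av andbT => /negPf ->.
Qed.

Let card_sub (m : nat) (A : set plane) (F : set plane) : F #= `I_m -> A `<=` F ->
  exists2 k, (k <= m)%N & A #= `I_k.
Proof.
move=> Fm AF; have fA : finite_set A.
  by apply: sub_finite_set AF _; apply/finite_setP; exists m.
have [k Ak] := proj1 (finite_setP _) fA; exists k => //.
by rewrite -card_le_II -(card_le_eql Ak) -(card_le_eqr Fm); exact: subset_card_le.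
Qed.

Let isolated_finite (A : set plane) p : finite_set A -> A p -> isolated A p.
Proof.
move=> fA Ap; split; first by rewrite inE.
exists (~` (A `\ p)).
  apply: open_nbhs_nbhs; split; last by move=> -[_ /(_ erefl)].
  apply: closed_openC; apply: (proj1 accessible_finite_set_closed).
    by apply: hausdorff_accessible; exact: norm_hausdorff.
  exact: finite_setD.
apply/seteqP; split=> [q [nq Aq]|q ->]; last by split=> // -[_ /(_ erefl)].
by apply: contrapT => qp; apply: nq.
Qed.

Let curves_finite i j : i != j -> finite_set (dcurve layout i `&` dcurve layout j).
Proof.
case: i j => [e|mu] [f|nu] ij.
- have [|p [q]] := @edge_edge_sub e f; first by apply: contra_neq ij => ->.
  by move=> /sub_finite_set; apply; exact: finite_set2.
- have [p] := edge_region_sub e nu.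
  by move=> /sub_finite_set; apply; exact: finite_set1.
- have [p] := edge_region_sub f mu; rewrite setIC.
  by move=> /sub_finite_set; apply; exact: finite_set1.
- rewrite (_ : _ `&` _ = set0); first exact: finite_set0.
  apply/seteqP; split=> // p [mp np].
  by apply: (region_region _ mp np); apply: contra_neq ij => ->.
Qed.

Lemma layout_is_drawing : is_drawing layout.
Proof.
split.
- split.
  + move=> v w /= [vwE]; apply/eqP; apply: contraPT vwE => /vx_inj /eqP; exact.
  + move=> e; split.
    * by apply: continuous_subspaceT; exact: tent_continuous.
    * exact: tent_inj.
    * have := @tent_left R (vx (val e).1) (vx (val e).2) (slope e) (height e) 0.
      by rewrite mul0r mulr0 mulr0 addr0 ; apply; rewrite lexx ler01.
    * have := @tent_right R (vx (val e).1) (vx (val e).2) (slope e) (height e) 0.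
      by rewrite mul0r mulr0 mulr0 addr0 subr0; apply; rewrite lexx ler01.
  + move=> e v; rewrite open_arc_tent// => -[_ /=]; by rewrite ltxx.
- by move=> mu; apply: simple_closed_region_box => //; have := top_gt0 mu; lra.
- move=> mu v; rewrite inE; have t0 := top_gt0 mu; have w0 := vw_ge0 v.
  case: ifP => [vin|/negbT vout].
    have [? ?] := vertex_in vin.
    by rewrite interior_box; split=> /=; apply/andP; split; lra.
  by move=> [/= /andP[? ?] _]; case: (vertex_out vout); lra.
- move=> mu nu; have [->|ne] := eqVneq mu nu; first by move=> _ q.
  move=> /box_nested /(_ ne)[? ? ?].
  by move=> q [/andP[? ?] /andP[? ?]]; split; apply/andP; split; lra.
- split.
  + by move=> i j p ij ijp; apply: isolated_finite => //; exact: curves_finite.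
  (* Of three curves through [p], two would both be at their level or both strictly below it,
     contrary to what holds for each pair. *)
  + move=> i j k ij ik jk; apply/seteqP; split=> // p [[ip jp] kp].
    have := curves_meet ij ip jp; have := curves_meet ik ip kp.
    have := curves_meet jk jp kp.
    by move=> [] [_ _ ? ?] [] [_ _ ? ?] [] [_ _ ? ?]; lra.
  + move=> i j p ij [ip jp]; case: (curves_meet ij ip jp) => -[ob fl _ _].
      by have [] := oblique_flat_alternate ob fl.
    by have [] := oblique_flat_alternate ob fl.
Qed.

Lemma layout_crossings : exists2 alpha : nat,
  (alpha <= 2 * #|cedge C| ^ 2)%N & crossings layout alpha 0 0.
Proof.
have eeP (ef : cedge C * cedge C) : exists m, (m <= 2)%N /\ (ef.1 != ef.2 ->
    open_arc (dedge layout ef.1) `&` open_arc (dedge layout ef.2) #= `I_m).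
  case: ef => e f /=; have [->|ne] := eqVneq e f; first by exists 0%N.
  have [p [q sub]] := edge_edge_sub ne.
  have [n2 n2le /card_sub] : exists2 m, (m <= 2)%N & [set p; q] #= `I_m.
    have [->|pq] := eqVneq p q; first by exists 1%N => //; rewrite setUid card_set1.
    exists 2%N => //; apply/eq_cardSP; exists p; first by left.
    rewrite (_ : [set p; q] `\ p = [set q]) ?card_set1//.
    apply/seteqP; split=> [x [[->|->]] //|x ->]; first by move=> /(_ erefl).
    by split; [right | move=> e'; move: pq; rewrite e' eqxx].
  by move=> /(_ _ sub)[m mle Im]; exists m; split=> //; exact: leq_trans n2le.
have erP (em : cedge C * 'I_(nclus C)) : exists m, (m <= 1)%N /\
    open_arc (dedge layout em.1) `&` boundary (dregion layout em.2) #= `I_m.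
  have [p sub] := edge_region_sub em.1 em.2.
  by have [m ? ?] := card_sub card_set1 sub; exists m.
have [ee eeH] := choice eeP; have [er erH] := choice erP.
exists (\sum_e \sum_(f | enum_rank e < enum_rank f) ee (e, f))%N.
  rewrite (@leq_trans (\sum_(e : cedge C) \sum_(f : cedge C) 2)%N)//.
    apply: leq_sum => e _; rewrite [leqLHS]big_mkcond; apply: leq_sum => f _.
    by case: ifP => // _; have [] := eeH (e, f).
  by rewrite !sum_nat_const -mulnn mulnA mulnC.
exists (fun e f => ee (e, f)), (fun e mu => er (e, mu)), (fun _ _ => 0%N); split.
- by move=> e f ef; have [_ /(_ ef)] := eeH (e, f).
- by move=> e mu; have [] := erH (e, mu).
(* Unrelated boxes are disjoint, so the difference is a whole box, which is connected: one
   component, hence no region-region crossing. *)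
- move=> mu nu unr.
  have con : connected (dregion layout mu).
    by apply: box_connected; [exact: ltW | have := top_gt0 mu; lra].
  have -> : dregion layout mu `\` dregion layout nu = dregion layout mu.
    apply/seteqP; split=> [q []//|q mq]; split=> // nq.
    move: mq nq => [/andP[? ?] _] [/andP[? ?] _].
    by case: (box_apart unr); lra.
  rewrite (_ : components _ = [set dregion layout mu]) ?card_set1//.
  have lm : dregion layout mu (left mu, 0).
    have := top_gt0 mu; have := left_right mu => ? ?.
    by split=> /=; apply/andP; split; lra.
  apply/seteqP; split=> [_ [q mq <-]|_ ->]; first by rewrite /= connected_component_id.
  by exists (left mu, 0) => //; rewrite connected_component_id.
- split=> //.
  (* At most one intersection of an edge with a boundary, and half of it rounds down to 0. *)
  + rewrite big1// => e _; rewrite big1// => mu _; apply: divn_small.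
    by have [] := erH (e, mu).
  + by rewrite big1// => mu _; rewrite big1.
Qed.

End Layout.

(** * The output of the algorithm is an instance of the layout *)

Section CodedLayout.
Variables (R : realType) (C : cgraph).
Notation inp := (code_cgraph C).
Notation m := #|cedge C|.

(** The countdown agrees with the one of [map_rank] and makes the ranks run from [m] down to 1. *)
Let edge_rank (e : cedge C) : nat := (m - index e (enum (cedge C)))%N.
Let vx (v : 'I_(nvert C)) : R := (in_left inp v)%:R.
Let vw (v : 'I_(nvert C)) : R := (in_width inp v)%:R.
Let lft (mu : 'I_(nclus C)) : R := (in_left inp (nvert C + mu))%:R.
Let rgt (mu : 'I_(nclus C)) : R :=
  (in_left inp (nvert C + mu) + in_width inp (nvert C + mu))%:R.
Let tp (mu : 'I_(nclus C)) : R := (in_top inp (nvert C + mu))%:R.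
Let sl (e : cedge C) : R := (edge_rank e)%:R.
Let ht (e : cedge C) : R := (in_height inp
  (nat_of_ord (val e).1, nat_of_ord (val e).2) (edge_rank e))%:R.

Let D := layout vx lft rgt tp sl ht.

Let edge_rank_gt0 e : (0 < edge_rank e)%N.
Proof. by rewrite subn_gt0 cardE index_mem mem_enum. Qed.

Let edge_rank_le e : (edge_rank e <= m)%N.
Proof. exact: leq_subr. Qed.

Let edge_rank_inj : injective edge_rank.
Proof.
move=> e f ef; have := edge_rank_gt0 e; have := edge_rank_gt0 f.
rewrite /edge_rank in ef *; move=> h1 h2.
have : index e (enum (cedge C)) = index f (enum (cedge C)) by lia.
have me g : g \in enum (cedge C) by rewrite mem_enum.
by move=> h; rewrite -(nth_index e (me e)) h nth_index.
Qed.

(** Only clusters can be parents, so vertices are leaves. Hence two distinct vertices are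
    incomparable, and [in_separated] applies to them. *)
Let leaf_connect (v : 'I_(nvert C)) y :
  connect (parent_rel (@par C)) y (inl v) -> y = inl v.
Proof.
move=> /connectP[p]; elim/last_ind: p => [|p w _]; first by move=> _ ->.
rewrite rcons_path last_rcons => /andP[_ pw] vw'; move: pw; rewrite -vw' /parent_rel /=.
by case: (par _).
Qed.

Let ht_gt0 e : 0 < ht e.
Proof. by rewrite ltr0n addn_gt0 edge_rank_gt0 orbT. Qed.

Let vx_apart v w : v != w -> vx v + vw v < vx w \/ vx w + vw w < vx v.
Proof.
move=> ne; rewrite /vx /vw -!natrD !ltr_nat.
have nc u u' : u != u' -> ~~ connect (parent_rel (@par C)) (inl u) (inl u').
  by move=> uu; apply: contra uu => /leaf_connect [->].
apply/orP; apply: (@in_separated C (inl v) (inl w)); apply: nc => //.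
by rewrite eq_sym.
Qed.

Let vx_in mu v : ancestor mu (inl v) -> lft mu < vx v /\ vx v + vw v < rgt mu.
Proof.
move=> a; have [|h1 h2] := @in_nested C (inl v) (inr mu) a; first by [].
by rewrite /lft /vx /vw /rgt -natrD !ltr_nat.
Qed.

Let vx_out mu v : ~~ ancestor mu (inl v) -> vx v + vw v < lft mu \/ rgt mu < vx v.
Proof.
move=> a; rewrite /lft /vx /vw /rgt -natrD !ltr_nat; apply/orP.
apply: (@in_separated C (inl v) (inr mu)) => //.
by apply/negP => /leaf_connect.
Qed.

Let boxes_nested mu nu : ancestor nu (inr mu) -> mu != nu ->
  [/\ lft nu < lft mu, rgt mu < rgt nu & tp mu < tp nu].
Proof.
move=> a ne; have ne' : inr mu != inr nu :> 'I_(nvert C) + 'I_(nclus C).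
  by apply: contra ne => /eqP[->].
have [h1 h2] := in_nested a ne'; have h3 := in_top_lt a ne'.
by rewrite /lft /rgt /tp !ltr_nat.
Qed.

Let boxes_apart mu nu : unrelated mu nu -> rgt mu < lft nu \/ rgt nu < lft mu.
Proof.
move=> /andP[h1 h2]; rewrite /lft /rgt !ltr_nat; apply/orP.
exact: (@in_separated C (inr mu) (inr nu)).
Qed.

Let edges_in (e : cedge C) mu : ancestor mu (inl (val e).1) ->
  ancestor mu (inl (val e).2) -> ht e < tp mu.
Proof.
by move=> h1 h2; rewrite ltr_nat; exact: (in_height_lt_top (edge_rank_le e) h1 h2).
Qed.

Let edges_out (e : cedge C) mu :
  ~~ (ancestor mu (inl (val e).1) && ancestor mu (inl (val e).2)) ->
  [\/ tp mu < ht e, rgt mu < vx (val e).1 /\ rgt mu < vx (val e).2 |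
      vx (val e).1 + vw (val e).1 < lft mu /\
      vx (val e).2 + vw (val e).2 < lft mu].
Proof.
move=> h; rewrite /tp /ht /rgt /vx /vw /lft -!natrD !ltr_nat.
exact: (in_top_lt_height (edge_rank_gt0 e) h).
Qed.

Let slopes_inj e f : e != f -> sl e != sl f.
Proof. by rewrite eqr_nat; apply: contra_neq => /edge_rank_inj. Qed.

Let heights_inj e f : e != f -> ht e != ht f.
Proof.
rewrite eqr_nat; apply: contra_neq => /in_height_inj.
by move=> /(_ (edge_rank_le e) (edge_rank_le f)) /edge_rank_inj.
Qed.

Let slope_height e v : sl e * ht e <= vw v.
Proof. by rewrite -natrM ler_nat; exact: (slope_height_le _ _ (inl v) (edge_rank_le e)). Qed.

Let tp_gt0 mu : 0 < tp mu.
Proof. by rewrite ltr0n (in_top_gt0 (inr mu)). Qed.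

Let lft_rgt mu : lft mu < rgt mu.
Proof.
by rewrite ltr_nat -[X in (X < _)%N]addn0 ltn_add2l; exact: (in_width_gt0 (inr mu)).
Qed.

Let vw_ge0 v : 0 <= vw v. Proof. exact: ler0n. Qed.

Let sl_ge0 e : 0 <= sl e. Proof. exact: ler0n. Qed.

Lemma point_val_pos (a b : nat) : point_val R (pos_point a b) = (a%:R, b%:R).
Proof. by rewrite /point_val /rat_val /= !subr0 !divr1. Qed.

Lemma point_val_corner (a s h : nat) :
  point_val R (pos_point (a + s * h)%N h) = (a%:R + s%:R * h%:R, h%:R).
Proof. by rewrite point_val_pos natrD natrM. Qed.

Lemma point_val_neg (a b : nat) : point_val R (neg_point a b) = (a%:R, - b%:R).
Proof. by rewrite /point_val /rat_val /= subr0 sub0r !divr1. Qed.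

Lemma algorithm_describes : describes (algorithm inp) D.
Proof.
split.
- rewrite /= /mkseq -val_enum_ord -!map_comp; apply: eq_map => v /=.
  by rewrite point_val_pos.
- rewrite /= /in_edges /= map_rank_map ?enum_uniq// -map_comp.
  apply: eq_map => e; rewrite /= -cardE.
  have /andP[lt _] := valP e; have ne : (val e).1 != (val e).2.
    by rewrite -val_eqE /= neq_ltn lt.
  have nx : vx (val e).1 != vx (val e).2.
    apply/eqP => eqx; have := vx_apart ne; rewrite eqx.
    by have := vw_ge0 (val e).1; have := vw_ge0 (val e).2; case; lra.
  apply: etrans (polyline_tent (sl e) nx (ht_gt0 e)).
  by rewrite /open_polygonal /= !point_val_corner !point_val_pos.
- rewrite /= /mkseq -val_enum_ord -!map_comp; apply: eq_map => mu /=.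
  have bt : - tp mu <= tp mu by have := tp_gt0 mu; lra.
  apply: etrans (polyline_box (ltW (lft_rgt mu)) bt).
  by rewrite /closed_polygonal /= !point_val_pos !point_val_neg.
Qed.

Lemma coded_layout_drawing : exists2 alpha : nat,
  (alpha <= 2 * m ^ 2)%N & crossing_drawing D alpha 0 0.
Proof.
have dr := layout_is_drawing vw_ge0 vx_apart sl_ge0 slopes_inj ht_gt0 heights_inj
  slope_height tp_gt0 lft_rgt vx_in vx_out boxes_nested boxes_apart edges_in edges_out.
have [alpha le cr] := layout_crossings vw_ge0 vx_apart sl_ge0 slopes_inj ht_gt0 heights_inj
  slope_height tp_gt0 lft_rgt vx_in vx_out boxes_apart edges_in edges_out.
by exists alpha.
Qed.

End CodedLayout.

Theorem theorem1 (R : realType) :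
  exists (A : prog input_ty output_ty) (c : nat),
    forall C : cgraph, planar R C ->
      exists out : dom output_ty,
        run A (code_cgraph C) out /\
        exists (D : drawing R C) (alpha : nat),
          describes out D /\
          crossing_drawing D alpha 0 0 /\
          (alpha <= c * nvert C ^ 2)%N.
Proof.
have [A runA] := computable_algorithm; exists A, 32%N => C plC.
exists (algorithm (code_cgraph C)); split; first exact: runA.
have [alpha le cr] := coded_layout_drawing R C.
eexists; exists alpha; split; first exact: algorithm_describes.
(* Squaring the bound on the number of edges turns [2 * m ^ 2] into [2 * 16 * n ^ 2], whence the
   constant 32. *)
split=> //; have := planar_sparse plC; rewrite -(leq_exp2r _ _ (ltn0Sn 1)).
by rewrite expnMn; lia.
Qed.
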